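(* Let $m\ge 3$ be an integer, let $N_m^{div}$ be the number of positive divisors of $m$ (including $1$ and $m$), let $\Xi_m^{geo}$ be the total number of different (geometrical) ways of cutting a regular $m$-gon with $d$-knives, $d$ running over all positive divisors of $m$, and let $N^{SS}_{r}$ denote the number of geometrical types of side-to-side cuts of a regular $r$-gon (all notions as defined in the context). Then $$\Xi_m^{geo}=N_m^{div}\,\bigl(m+1+N^{SS}_{m-2}\bigr)\quad\text{if } m=2k \text{ is even},$$ $$\Xi_m^{geo}=N_m^{div}\,\bigl(m+2+N^{SS}_{m-2}\bigr)\quad\text{if } m=2k+1 \text{ is odd}.$$
   Context: Let $P$ be a regular $m$-gon with vertices $V_1,\dots,V_m$ in clockwise cyclic order and sides $S_i$ from $V_i$ to $V_{i+1}$ (indices mod $m$); let $O$ be its centre. A cut is a straight chord of $P$ with two endpoints on the boundary of $P$ that divides $P$ into exactly two pieces of positive area. It is a $VV$ cut if both endpoints are vertices, a $VS$ cut if one endpoint is a vertex and the other is in the relative interior of a side, and an $SS$ cut if the endpoints are in the relative interiors of two different sides. (Hence chords lying along a side are excluded.) Geometrical type. Two cuts $c,c'$ have the same geometrical type if there is a symmetry $g$ of $P$ (rotation or reflection) such that: (a) the endpoints of $g(c)$ lie in the same vertices / open sides as the endpoints of $c'$; (b) the centre $O$ is in the same position with respect to $g(c)$ and $c'$, i.e. it lies on both chords, or it lies off both chords and, in the two cases, in the interior of the piece containing the same set of vertices of $P$ off the chord; (c) if they are $SS$ cuts with endpoints on the sides $S_i$ and $S_j$, $i<j$, and if $s$ denotes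 the distance from $V_i$ to the endpoint on $S_i$ and $t$ the distance from $V_j$ to the endpoint on $S_j$, then the comparison between $s$ and $t$ ($s<t$, $s=t$ or $s>t$) is the same for $g(c)$ and $c'$. For $r\ge 3$, $N_r^{SS}$ is the number of geometrical types of $SS$ cuts of a regular $r$-gon. By convention $N_1^{SS}=N_2^{SS}=2$. For a positive divisor $d$ of $m$, the $d$-knife generated by a cut $c$ makes the $d$ cuts obtained by rotating $c$ about $O$ through the multiples of $2\pi/d$. A (geometrical) way of cutting $P$ is a pair consisting of a positive divisor $d$ of $m$ and a geometrical type of a generating cut $c$; ways of cutting for different divisors $d$ are counted separately. $\Xi_m^{geo}$ is the total number of these pairs. *)

(* Defs.v *)
(* MathComp-Analysis: the plane is R * R for R : realType. *)
From HB Require Import structures.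
From mathcomp Require Import all_boot all_order all_algebra finmap.
From mathcomp Require Import all_classical all_reals all_analysis.
Import Order.TTheory GRing.Theory Num.Theory.
Import numFieldNormedType.Exports.

Set Implicit Arguments.
Unset Strict Implicit.
Unset Printing Implicit Defensive.

Local Open Scope classical_set_scope.
Local Open Scope ring_scope.

Section Plane.
Context {R : realType}.
Implicit Types x y : R * R.

(* The canonical norm of R * R is the sup norm, hence this definition. *)
Definition dist x y : R :=
  Num.sqrt ((x.1 - y.1) ^+ 2 + (x.2 - y.2) ^+ 2).

Definition segment x y : set (R * R) :=
  [set (1 - t) *: x + t *: y | t in `[0, 1]].

Definition open_segment x y : set (R * R) :=
  [set (1 - t) *: x + t *: y | t in `]0, 1[].

Definition area : set (R * R) -> \bar R :=
  (@lebesgue_measure R \x @lebesgue_measure R)%E.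

Definition rotation (o : R * R) (a : R) x : R * R :=
  (o.1 + cos a * (x.1 - o.1) - sin a * (x.2 - o.2),
   o.2 + sin a * (x.1 - o.1) + cos a * (x.2 - o.2)).

(* Reflection in the line through o with polar angle a / 2. *)
Definition reflection (o : R * R) (a : R) x : R * R :=
  (o.1 + cos a * (x.1 - o.1) + sin a * (x.2 - o.2),
   o.2 + sin a * (x.1 - o.1) - cos a * (x.2 - o.2)).

End Plane.

(* A regular m-gon with a clockwise labelling of its vertices is determined by
   its centre, its circumradius and the polar angle of the vertex number 0. It
   is a genuine polygon only for 3 <= m. *)
Record regular_polygon (R : realType) (m : nat) := RegularPolygon {
  center : R * R;
  radius : R;
  phase : R;
  radius_gt0 : 0 < radius }.

(* The two endpoints of a chord, listed in some order; every notion below is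
   insensitive to that order. *)
Definition chord (R : realType) : Type := ((R * R) * (R * R))%type.

Section RegularPolygon.
Context {R : realType} {m : nat} (P : regular_polygon R m).
Implicit Types (c : chord R) (A : set (R * R)) (k : nat) (g : R * R -> R * R).

(* Vertices and sides are numbered from 0. The vertex function is periodic
   modulo m, so that indices in nat are indices mod m. *)
Definition vertex k : R * R :=
  let a := phase P - 2 * pi * k%:R / m%:R in
  ((center P).1 + radius P * cos a, (center P).2 + radius P * sin a).

Definition side k : set (R * R) := segment (vertex k) (vertex k.+1).

Definition open_side k : set (R * R) := open_segment (vertex k) (vertex k.+1).

(* The convex hull of the vertices. *)
Definition region : set (R * R) :=
  [set x | exists w : 'I_m -> R,
     [/\ forall i, 0 <= w i, \sum_i w i = 1 & x = \sum_i w i *: vertex i]].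

Definition boundary : set (R * R) := [set x | exists i : 'I_m, side i x].

Definition symmetry g : Prop :=
  (exists a : R, g = rotation (center P) a \/ g = reflection (center P) a) /\
  g @` region = region.

Definition chord_set c : set (R * R) := segment c.1 c.2.

Definition chord_image g c : chord R := (g c.1, g c.2).

Definition has_endpoint_in c A : Prop := A c.1 \/ A c.2.

(* The pieces are the connected components of the polygon minus the chord, so
   that they contain no point of the chord. *)
Definition pieces c : set (set (R * R)) :=
  [set connected_component (region `\` chord_set c) x
    | x in region `\` chord_set c].

Definition is_cut c : Prop :=
  [/\ boundary c.1, boundary c.2, (pieces c #= `I_2)%card &
      forall Q, pieces c Q -> (0 < area Q)%E].

Definition is_SS_cut c : Prop :=
  is_cut c /\
  exists i j : 'I_m, [/\ i != j, open_side i c.1 & open_side j c.2].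

Definition same_support c c' : Prop :=
  forall i : 'I_m,
    (has_endpoint_in c [set vertex i] <-> has_endpoint_in c' [set vertex i]) /\
    (has_endpoint_in c (open_side i) <-> has_endpoint_in c' (open_side i)).

Definition same_center_position c c' : Prop :=
  (chord_set c (center P) /\ chord_set c' (center P)) \/
  exists Q Q' : set (R * R),
    [/\ pieces c Q, pieces c' Q', interior Q (center P),
        interior Q' (center P) &
        forall i : 'I_m, Q (vertex i) <-> Q' (vertex i)].

Definition same_comparison c c' : Prop :=
  forall (i j : 'I_m) (x y x' y' : R * R), (i < j)%N ->
    has_endpoint_in c [set x] -> open_side i x ->
    has_endpoint_in c [set y] -> open_side j y ->
    has_endpoint_in c' [set x'] -> open_side i x' ->
    has_endpoint_in c' [set y'] -> open_side j y' ->
    let s := dist (vertex i) x in let t := dist (vertex j) y in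
    let s' := dist (vertex i) x' in let t' := dist (vertex j) y' in
    [/\ s < t <-> s' < t', s = t <-> s' = t' & t < s <-> t' < s'].

Definition same_geotype c c' : Prop :=
  exists2 g, symmetry g &
    [/\ same_support (chord_image g c) c',
        same_center_position (chord_image g c) c' &
        same_comparison (chord_image g c) c'].

Definition geotype c : set (chord R) :=
  [set c' | is_cut c' /\ same_geotype c c'].

(* The knife of a divisor d and a cut c makes the d images of c under the
   rotations through multiples of 2 * pi / d; a way of cutting only records d
   and the type of c. *)
Definition ways_of_cutting : set (nat * set (chord R)) :=
  [set dt | (0 < dt.1)%N /\ (dt.1 %| m)%N /\
            exists2 c, is_cut c & dt.2 = geotype c].

Definition Xi_geo : nat := #|` fset_set ways_of_cutting|.

(* The values for m <= 2 are conventional. *)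
Definition N_SS : nat :=
  if (m <= 2)%N then 2%N else #|` fset_set (geotype @` is_SS_cut)|.

End RegularPolygon.

Definition N_div (m : nat) : nat := size (divisors m).

(* Main.v *)
From Pilot Require Import Defs.
From mathcomp Require Import all_boot all_order all_algebra.
From mathcomp Require Import finmap zify ring lra.
From mathcomp Require Import all_classical all_reals all_analysis.
Import Pilot.Defs.

Import Order.TTheory GRing.Theory Num.Theory.
Import numFieldNormedType.Exports.

Set Implicit Arguments.
Unset Strict Implicit.
Unset Printing Implicit Defensive.

Local Open Scope classical_set_scope.
Local Open Scope ring_scope.

(** The geometrical types of cuts can be described by four discrete data, and
both sides of the theorem count admissible values of these data.

Cut the boundary of the m-gon into 2 m cells, the vertices and the open sides,
numbered clockwise modulo 2 m: vertex i is the cell 2 i and the side that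
follows it is the cell 2 i + 1. A chord between two boundary points is a cut
exactly when no closed side contains both of them. If one does, what the chord
leaves of the polygon is still star-shaped about the centre, hence in one piece
([common_side_not_cut]). If none does, the chord is the whole trace of its line
on the polygon, and its pieces are the two convex halves of the polygon given
by the sign of an orientation determinant ([separated_pieces],
[separated_is_cut]). So the centre is placed by the sign of a determinant, and
the vertices of each piece are those of the arc between the two cells.

Read from its first endpoint p to its second endpoint q, a cut thus has the
data (d, b, sg, rh): the clockwise distance d from the cell of p to that of q,
whether both cells are sides, the side sg of the line pq on which the centre
lies, and, for two sides, the comparison rh of the distances t and s of the
endpoints from the starting vertices of their sides. Turning the polygon keeps
these data. A reflection reverses the boundary, exchanges the two endpoints and
replaces s and t by 1 - s and 1 - t, so it keeps them too. Reading the same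
chord from q to p turns (d, b, sg, rh) into (2 m - d, b, - sg, - rh). Symmetries
of the polygon are exactly the turns and flips of its vertices ([symmetryP]),
since a symmetry sends a vertex to a point of the circumcircle, and those in
the polygon are its vertices. Hence two cuts have the same geometrical type
precisely when their data agree up to the choice of reading
([same_geotypeP]), and one can choose the reading with d < m, or d = m and
sg >= 0 ([normal]).

It remains to see which normal data occur ([type_feasible], [SS_realized] and
its companions). The determinant of p, q and the centre is bilinear in s and t,
with coefficients sin (2 pi n / m). If the arc from p to q certainly spans
less than half a turn, then sg = 1 and rh is free. Otherwise
- between vertex and vertex, d = m, and the centre is on the chord;
- between vertex and side, d = m is odd, and the centre may be on or off the
  chord, which gives one type more;
- between side and side with m odd, d = m - 1, and sg = 0 or sg = -1 are
  possible too, but only with s < t, which gives two types more;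
- between side and side with m even, d = m, and sg = - rh, which leaves the two
  types rh = 0 and rh = -1.
With floors written as [ ], there are [m / 2] - 1 types between vertices,
[(m - 1) / 2] between vertex and side, plus one if m is odd, and
3 [(m - 1) / 2] + 2 types between sides. The last expression is 2 for m = 1 and
m = 2, in accordance with the convention for these values, so that it can be
used for the (m - 2)-gon for every m >= 3. The theorem follows by comparing the
two sums, as each type is paired with each divisor of m. *)

(** * Orientation, connectedness and area in the plane *)

Section PlaneGeometry.
Context {R : realType}.
Implicit Types (p q x y z : R * R) (A B : set (R * R)).

(** Minus the cross product of q - p and x - p: positive when p, q, x turn
clockwise, the direction in which the vertices are numbered. *)
Definition orient p q x : R :=
  (q.2 - p.2) * (x.1 - p.1) - (q.1 - p.1) * (x.2 - p.2).

Definition convex_set A := forall x y t, A x -> A y -> 0 <= t <= 1 ->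
  A ((1 - t) *: x + t *: y).

Lemma orient_comb p q x y t :
  orient p q ((1 - t) *: x + t *: y)
  = (1 - t) * orient p q x + t * orient p q y.
Proof. rewrite /orient /= /GRing.scale /=; ring. Qed.

Lemma orient_rot p q x : orient p q x = orient q x p.
Proof. rewrite /orient; ring. Qed.

Lemma orient_swap p q x : orient q p x = - orient p q x.
Proof. rewrite /orient; ring. Qed.

Lemma sum_fst n (w : 'I_n -> R) (v : 'I_n -> R * R) :
  (\sum_a w a *: v a).1 = \sum_a w a * (v a).1.
Proof. by rewrite (big_morph fst (id1 := 0) (op1 := +%R)). Qed.

Lemma sum_snd n (w : 'I_n -> R) (v : 'I_n -> R * R) :
  (\sum_a w a *: v a).2 = \sum_a w a * (v a).2.
Proof. by rewrite (big_morph snd (id1 := 0) (op1 := +%R)). Qed.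

Lemma orient_sum n (w : 'I_n -> R) (v : 'I_n -> R * R) p q :
  \sum_i w i = 1 ->
  orient p q (\sum_i w i *: v i) = \sum_i w i * orient p q (v i).
Proof.
move=> w1.
rewrite /orient sum_fst sum_snd.
transitivity ((q.2 - p.2) * (\sum_i w i * (v i).1 - (\sum_i w i) * p.1)
  - (q.1 - p.1) * (\sum_i w i * (v i).2 - (\sum_i w i) * p.2)).
  by rewrite w1 !mul1r.
rewrite !mulr_suml -!sumrB !mulr_sumr -sumrB.
by apply: eq_bigr => i _; ring.
Qed.

Lemma continuous_orient p q : continuous (orient p q).
Proof.
move=> x; apply: cvgB; apply: cvgM; [exact: cvg_cst| |exact: cvg_cst|].
  by apply: cvgB; [exact: cvg_fst|exact: cvg_cst].
by apply: cvgB; [exact: cvg_snd|exact: cvg_cst].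
Qed.

Lemma starshaped_connected A x0 : A x0 ->
  (forall x t, A x -> 0 <= t <= 1 -> A ((1 - t) *: x0 + t *: x)) ->
  connected A.
Proof.
move=> Ax0 hA.
have -> : A = \bigcup_(x in A) ((fun t : R => (1 - t) *: x0 + t *: x) @` `[0, 1]).
  apply/seteqP; split => [x Ax|x [y Ay [t]]] /=.
    exists x => //; exists 1; first by rewrite /= in_itv /= ler01 lexx.
    by rewrite subrr scale0r add0r scale1r.
  by rewrite in_itv /= => t01 <-; exact: hA.
apply: bigcup_connected.
  exists x0 => x Ax; exists 0; first by rewrite /= in_itv /= ler01 lexx.
  by rewrite subr0 scale0r addr0 scale1r.
move=> x Ax; apply: connected_continuous_connected.
  exact: segment_connected.
apply: continuous_subspaceT => t.
apply: cvgD; apply: cvgZ; [|exact: cvg_cst| |exact: cvg_cst].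
  by apply: cvgB; [exact: cvg_cst|exact: cvg_id].
exact: cvg_id.
Qed.

Lemma connected_nonvanishing_gt0 (f : R * R -> R) A x :
  continuous f -> connected A -> (forall y, A y -> f y != 0) -> A x ->
  0 < f x -> forall y, A y -> 0 < f y.
Proof.
move=> cf cA nA Ax fx0 y Ay; rewrite lt_neqAle eq_sym nA //=.
rewrite leNgt; apply/negP => fy0.
have /connected_intervalP : connected (f @` A).
  by apply: connected_continuous_connected => //; exact: continuous_subspaceT.
move=> /(_ (f y) (f x)) /(_ (ex_intro2 _ _ _ Ay erefl)).
move=> /(_ (ex_intro2 _ _ _ Ax erefl)) /(_ 0).
by rewrite (ltW fy0) (ltW fx0) => /(_ isT)[z Az fz]; move: (nA z Az); rewrite fz eqxx.
Qed.

(** The set A need not be measurable: the Lebesgue measure of the sections is an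
outer measure, and the integral of a nonnegative function is a supremum over
the simple functions below it, so both are monotone on all sets and
functions. *)
Lemma area_box_gt0 (a b c d : R) A : a < b -> c < d ->
  (forall x, a < x.1 < b -> c < x.2 < d -> A x) -> (0 < area A)%E.
Proof.
move=> ab cd hA.
have : (0 < area (`]a, b[ `*` `]c, d[))%E.
  rewrite /area product_measure1E; [|exact: measurable_itv..].
  have itvE (u v : R) : u < v -> (@lebesgue_measure R `]u, v[%classic = (v - u)%:E)%E.
    by move=> uv; rewrite lebesgue_measure_itv /= lte_fin uv EFinB.
  have : (0 < (b - a)%:E * (d - c)%:E)%E by rewrite -EFinM lte_fin mulr_gt0 ?subr_gt0.
  by rewrite -(itvE _ _ ab) -(itvE _ _ cd) => H; exact: H.
move=> /lt_le_trans; apply.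
have sub : `]a, b[ `*` `]c, d[ `<=` A.
  by move=> x [] /=; rewrite !in_itv /=; exact: hA.
rewrite /area /product_measure1 !ge0_integralE //.
apply: ereal_sup_le => _ [h hh <-]; exists h => //= x; apply: le_trans (hh x) _ => /=.
rewrite !patchT ?inE //=.
rewrite /lebesgue_measure /lebesgue_stieltjes_measure /measure_extension.
apply: le_outer_measure => y; rewrite /xsection /= !inE; exact: sub.
Qed.

End PlaneGeometry.

(** * Trigonometric sums and orientations on the unit circle *)

Section Trig.
Context {R : realType}.
Implicit Types (a b x y : R).

Lemma cos_sin_period (x : R) (n : int) :
  cos (x + 2 * pi * n%:~R) = cos x /\ sin (x + 2 * pi * n%:~R) = sin x.
Proof.
have H (k : nat) y : cos (y + 2 * pi * k%:R) = cos y /\ sin (y + 2 * pi * k%:R) = sin y.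
  elim: k => [|k [IHc IHs]]; first by rewrite mulr0 addr0.
  have -> : y + 2 * pi * k.+1%:R = (y + 2 * pi * k%:R) + pi *+ 2.
    by rewrite -natr1 mulr2n; ring.
  by rewrite cosD2pi sinD2pi.
case: n => n; first exact: H.
have [hc hs] := H n.+1 (x + 2 * pi * (Negz n)%:~R).
rewrite -hc -hs NegzE mulrNz.
have -> : x + 2 * pi * - (n.+1)%:~R + 2 * pi * n.+1%:R = x by rewrite -pmulrn; ring.
by [].
Qed.

(** In half angles each of 1, x and y is a quadratic form on the circle, so the
determinant becomes a homogeneous polynomial, the Vandermonde product of the
three points. *)
Lemma orient_circle (ca sa cb sb cc sc : R) :
  ca ^+ 2 + sa ^+ 2 = 1 -> cb ^+ 2 + sb ^+ 2 = 1 -> cc ^+ 2 + sc ^+ 2 = 1 ->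
  orient (ca ^+ 2 - sa ^+ 2, 2 * sa * ca) (cb ^+ 2 - sb ^+ 2, 2 * sb * cb)
    (cc ^+ 2 - sc ^+ 2, 2 * sc * cc)
  = 4 * (sa * cb - ca * sb) * (sb * cc - cb * sc) * (sa * cc - ca * sc).
Proof.
move=> ha hb hc; rewrite /orient /=.
transitivity ((2 * sb * cb - 2 * sa * ca) * (cc ^+ 2 - sc ^+ 2)
 - (cb ^+ 2 - sb ^+ 2 - (ca ^+ 2 - sa ^+ 2)) * (2 * sc * cc)
 - 1 * ((2 * sb * cb) * (ca ^+ 2 - sa ^+ 2) - (cb ^+ 2 - sb ^+ 2) * (2 * sa * ca))); first by ring.
(* Each of the three minors is multiplied by one squared norm. *)
transitivity (
 (cb ^+ 2 + sb ^+ 2) * ((cc ^+ 2 - sc ^+ 2) * (- (2 * sa * ca)) + (ca ^+ 2 - sa ^+ 2) * (2 * sc * cc))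
 + (ca ^+ 2 + sa ^+ 2) * ((cc ^+ 2 - sc ^+ 2) * ((2 * sb * cb)) - (cb ^+ 2 - sb ^+ 2) * (2 * sc * cc))
 - (cc ^+ 2 + sc ^+ 2) * ((2 * sb * cb) * (ca ^+ 2 - sa ^+ 2) - (cb ^+ 2 - sb ^+ 2) * (2 * sa * ca))).
  by rewrite ha hb hc; ring.
ring.
Qed.

Lemma cos_double x : cos (2 * x) = cos x ^+ 2 - sin x ^+ 2.
Proof. by rewrite mulr_natl cos_mulr2n sin2cos2; ring. Qed.

Lemma sin_double x : sin (2 * x) = 2 * sin x * cos x.
Proof. by rewrite mulr_natl sin_mulr2n; ring. Qed.

Lemma orient_unit_circle a b c :
  orient (cos (2 * a), sin (2 * a)) (cos (2 * b), sin (2 * b))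
    (cos (2 * c), sin (2 * c))
  = 4 * sin (a - b) * sin (b - c) * sin (a - c).
Proof. by rewrite !cos_double !sin_double orient_circle ?cos2Dsin2// !sinB. Qed.

(** Multiplied by sin d, the sum telescopes to a difference of two sines whose
arguments differ by the multiple 2 n d of 2 pi. *)
Lemma sum_cos_progression (x d : R) (n : nat) (k : int) :
  sin d != 0 -> n%:R * d = pi * k%:~R ->
  \sum_(i < n) cos (x - 2 * i%:R * d) = 0.
Proof.
move=> sd hd; apply: (mulfI sd); rewrite mulr0 mulr_sumr.
rewrite -(big_mkord xpredT (fun i => sin d * cos (x - 2 * i%:R * d))).
pose u i := - sin (x - 2 * i%:R * d + d) / 2.
rewrite (eq_big_nat _ _ (F2 := fun i => u i.+1 - u i)); last first.
  move=> i _; rewrite /u.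
  have -> : x - 2 * i.+1%:R * d + d = (x - 2 * i%:R * d) - d by rewrite -natr1; ring.
  by set y := x - _; rewrite sinB sinD; field.
rewrite telescope_sumr // /u mulr0 mul0r subr0.
have -> : x - 2 * n%:R * d + d = x + d + 2 * pi * (- k)%:~R.
  by rewrite -[2 * n%:R * d]mulrA hd mulrNz; ring.
have [_ ->] := cos_sin_period (x + d) (- k); ring.
Qed.

Lemma sum_sin_progression (x d : R) (n : nat) (k : int) :
  sin d != 0 -> n%:R * d = pi * k%:~R ->
  \sum_(i < n) sin (x - 2 * i%:R * d) = 0.
Proof.
move=> sd hd; rewrite -[RHS](sum_cos_progression (x - pi / 2) sd hd).
apply: eq_bigr => i _; rewrite -cosBpihalf; congr cos; ring.
Qed.

Lemma cos_eq1_angle a b : cos (a - b) = 1 -> cos a = cos b /\ sin a = sin b.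
Proof.
rewrite cosB => h.
have ha := cos2Dsin2 a; have hb := cos2Dsin2 b.
have s0 : (cos a - cos b) ^+ 2 + (sin a - sin b) ^+ 2 = 0 by rewrite !sqrrB; lra.
move/eqP: s0; rewrite paddr_eq0 ?sqr_ge0// !sqrf_eq0 !subr_eq0.
by move=> /andP[/eqP -> /eqP ->].
Qed.

End Trig.

(** * The vertices, sides and region of a regular polygon *)

Section Polygon.
Context {R : realType} {m : nat} (hm : (3 <= m)%N) (P : regular_polygon R m).
Implicit Types (p q x y z : R * R) (i j k l : int) (e f : bool) (s t : R).

Let m0 : (m%:R : R) != 0.
Proof. by rewrite pnatr_eq0; lia. Qed.

(** The vertex numbers are integers rather than residues, so that arcs longer
than a turn and negative indices need no reduction. The angle is written as
twice a half angle, the form used by [orient_unit_circle]. *)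
Definition vtx l : R * R :=
  let a := 2 * (phase P / 2 - pi / m%:R * l%:~R) in
  ((center P).1 + radius P * cos a, (center P).2 + radius P * sin a).

Lemma vertexE (k : nat) : vertex P k = vtx k%:Z.
Proof.
rewrite /vertex /vtx /=.
by have -> : phase P - 2 * pi * k%:R / m%:R =
  2 * (phase P / 2 - pi / m%:R * k%:Z%:~R) by rewrite -pmulrn; field.
Qed.

Lemma vtxD l k : vtx (l + k * m%:Z) = vtx l.
Proof.
rewrite /vtx /=.
have -> : 2 * (phase P / 2 - pi / m%:R * (l + k * m%:Z)%:~R)
  = 2 * (phase P / 2 - pi / m%:R * l%:~R) + 2 * pi * (- k)%:~R.
  by rewrite intrD intrM mulrNz -[m%:Z%:~R]pmulrn; field.
by have [-> ->] := cos_sin_period (2 * (phase P / 2 - pi / m%:R * l%:~R)) (- k).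
Qed.

Lemma vtx_mod l : vtx l = vtx (l %% m%:Z)%Z.
Proof. by rewrite {1}(divz_eq l m) addrC vtxD. Qed.

(** The sine of the angle that the arc from a vertex to the l-th next one subtends
on the circle; twice the radius times it is, up to sign, the distance of these
vertices. *)
Definition sin_frac l : R := sin (pi / m%:R * l%:~R).

Lemma sin_frac_gt0 l : 0 < l < m%:Z -> 0 < sin_frac l.
Proof.
move=> /andP[l0 lm]; apply: sin_gt0_pi.
have l0' : (0 : R) < l%:~R by rewrite ltr0z.
have m0' : (0 : R) < m%:R by rewrite ltr0n; lia.
apply/andP; split; first by rewrite mulr_gt0 // divr_gt0 // pi_gt0.
rewrite -mulrA -[ltRHS]mulr1 ltr_pM2l ?pi_gt0 // mulrC ltr_pdivrMr // mul1r.
by rewrite pmulrn ltr_int.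
Qed.

Lemma sin_frac0 : sin_frac 0 = 0.
Proof. by rewrite /sin_frac mulr0 sin0. Qed.

Lemma sin_fracN l : sin_frac (- l) = - sin_frac l.
Proof. by rewrite /sin_frac mulrNz mulrN sinN. Qed.

Lemma sin_frac_compl l : sin_frac (m%:Z - l) = sin_frac l.
Proof.
rewrite /sin_frac intrB -[m%:Z%:~R]pmulrn mulrBr divfK // sinB sinpi cospi; ring.
Qed.

Lemma sin_frac_ge0 l : 0 <= l <= m%:Z -> 0 <= sin_frac l.
Proof.
move=> lm; have [->|l0] := eqVneq l 0; first by rewrite sin_frac0.
have [->|lm'] := eqVneq l m; first by rewrite -[m%:Z]subr0 sin_frac_compl sin_frac0.
by apply/ltW/sin_frac_gt0; lia.
Qed.

Lemma orient_vtx i j k : orient (vtx i) (vtx j) (vtx k)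
  = 4 * radius P ^+ 2 * sin_frac (j - i) * sin_frac (k - j) * sin_frac (k - i).
Proof.
transitivity (radius P ^+ 2 * orient
   (cos (2 * (phase P / 2 - pi / m%:R * i%:~R)), sin (2 * (phase P / 2 - pi / m%:R * i%:~R)))
   (cos (2 * (phase P / 2 - pi / m%:R * j%:~R)), sin (2 * (phase P / 2 - pi / m%:R * j%:~R)))
   (cos (2 * (phase P / 2 - pi / m%:R * k%:~R)), sin (2 * (phase P / 2 - pi / m%:R * k%:~R)))).
  rewrite /orient /vtx /=; ring.
rewrite orient_unit_circle /sin_frac !intrB.
have E a b : phase P / 2 - pi / m%:R * a - (phase P / 2 - pi / m%:R * b)
  = pi / m%:R * (b - a) by ring.
rewrite !E; ring.
Qed.

Let r0 := radius_gt0 P.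

Lemma orient_vtx_ge0 i j k : i <= j -> j <= k -> k <= i + m%:Z ->
  0 <= orient (vtx i) (vtx j) (vtx k).
Proof.
move=> ij jk ki; rewrite orient_vtx.
have r2 : 0 <= 4 * radius P ^+ 2 by rewrite mulr_ge0 // sqr_ge0.
by apply: mulr_ge0; [apply: mulr_ge0; [apply: mulr_ge0 => //|]|]; apply: sin_frac_ge0; lia.
Qed.

Lemma orient_vtx_gt0 i j k : i < j -> j < k -> k < i + m%:Z ->
  0 < orient (vtx i) (vtx j) (vtx k).
Proof.
move=> ij jk ki; rewrite orient_vtx.
have r2 : 0 < 4 * radius P ^+ 2 by rewrite mulr_gt0 // exprn_gt0.
by apply: mulr_gt0; [apply: mulr_gt0; [apply: mulr_gt0 => //|]|]; apply: sin_frac_gt0; lia.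
Qed.

(** A positive multiple of the distance to the line through side i, counted
positive towards the polygon. *)
Definition side_height i x := orient (vtx i) (vtx (i + 1)) x.

Lemma side_height_vtx_ge0 i l : 0 <= side_height i (vtx l).
Proof.
rewrite /side_height -(vtxD l (- ((l - i) %/ m%:Z)%Z)).
have [n0 nm] : 0 <= ((l - i) %% m%:Z)%Z /\ ((l - i) %% m%:Z)%Z < m%:Z.
  by rewrite modz_ge0 ?ltz_pmod; lia.
have E := divz_eq (l - i) m.
have -> : l + - ((l - i) %/ m%:Z)%Z * m%:Z = i + ((l - i) %% m%:Z)%Z.
  by rewrite mulNr; lia.
set n := ((l - i) %% m%:Z)%Z in n0 nm *.
have [->|n1] := eqVneq n 0; first by rewrite addr0 (_ : orient _ _ _ = 0) // /orient; ring.
by apply: orient_vtx_ge0; lia.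
Qed.

(** The boundary point in the cell (i, e): vertex i if e is false, the point that
divides the side after it in the ratio s : 1 - s if e is true. *)
Definition side_point i e s : R * R :=
  if e then (1 - s) *: vtx i + s *: vtx (i + 1) else vtx i.

Lemma side_pointD i k e s : side_point (i + k * m%:Z) e s = side_point i e s.
Proof.
rewrite /side_point !vtxD (_ : i + k * m%:Z + 1 = i + 1 + k * m%:Z) ?vtxD //; lia.
Qed.

Lemma side_height_self i e s : side_height i (side_point i e s) = 0.
Proof.
rewrite /side_point; case: e; rewrite /side_height ?orient_comb /orient; ring.
Qed.

Lemma side_height_point_ge0 i j e s : 0 < s < 1 -> 0 <= side_height i (side_point j e s).
Proof.
move=> /andP[s0 s1]; rewrite /side_point; case: e; last exact: side_height_vtx_ge0.
rewrite /side_height orient_comb addr_ge0 // mulr_ge0 // ?side_height_vtx_ge0 //; lra.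
Qed.

Lemma side_height_point_gt0 i j e s : 0 < s < 1 ->
  0 < j - i < m%:Z -> ~~ e ==> (1 < j - i) -> 0 < side_height i (side_point j e s).
Proof.
move=> /andP[s0 s1] ji he; rewrite /side_point /side_height; case: e he => /= he; last first.
  by apply: orient_vtx_gt0; lia.
rewrite orient_comb.
have s1' : 0 < 1 - s by lra.
have [j1|j1] := boolP (j - i == 1).
  have -> : j = i + 1 by lia.
  apply: ltr_wpDl; first by rewrite mulr_ge0 ?side_height_vtx_ge0 // ltW.
  by rewrite mulr_gt0 //; apply: orient_vtx_gt0; lia.
apply: ltr_wpDr; first by rewrite mulr_ge0 ?side_height_vtx_ge0 // ltW.
by rewrite mulr_gt0 //; apply: orient_vtx_gt0; lia.
Qed.

Lemma vtx_ord i : exists k : 'I_m, vtx i = vertex P k.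
Proof.
have n0 : 0 <= (i %% m%:Z)%Z by rewrite modz_ge0; lia.
have nm : (i %% m%:Z)%Z < m%:Z by rewrite ltz_pmod; lia.
have lt : (`|(i %% m%:Z)%Z| < m)%N by lia.
exists (Ordinal lt); rewrite vertexE vtx_mod /=; congr vtx; lia.
Qed.

(** The region is closed under convex combinations of any length, which reduces
its invariance under an affine map to the images of the vertices. *)
Lemma region_conv n (w : 'I_n -> R) (v : 'I_n -> R * R) :
  (forall a, 0 <= w a) -> \sum_a w a = 1 -> (forall a, region P (v a)) ->
  region P (\sum_a w a *: v a).
Proof.
move=> w0 w1 vR.
have /choice[u hu] : forall a, exists u : 'I_m -> R,
  [/\ forall b, 0 <= u b, \sum_b u b = 1 & v a = \sum_b u b *: vertex P b].
  by move=> i; have [u] := vR i; exists u.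
exists (fun b => \sum_a w a * u a b); split.
- by move=> j; apply: sumr_ge0 => i _; rewrite mulr_ge0 //; have [] := hu i.
- rewrite exchange_big -[RHS]w1 /=; apply: eq_bigr => i _.
  by rewrite -mulr_sumr; have [_ -> _] := hu i; rewrite mulr1.
- under [RHS]eq_bigr do rewrite scaler_suml.
  rewrite exchange_big /=; apply: eq_bigr => i _.
  have [_ _ ->] := hu i; rewrite scaler_sumr; apply: eq_bigr => j _.
  by rewrite scalerA.
Qed.

Lemma region_convex : convex_set (region P).
Proof.
move=> x y t Ax Ay /andP[t0 t1].
have := @region_conv 2 (fun a => if a == ord0 then 1 - t else t)
  (fun a => if a == ord0 then x else y).
rewrite !big_ord_recl !big_ord0 /= !addr0; apply.
- by move=> i; case: ifP => _ //; rewrite subr_ge0.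
- by rewrite subrK.
- by move=> i; case: ifP.
Qed.

Lemma region_vertex (k : 'I_m) : region P (vertex P k).
Proof.
exists (fun a => (a == k)%:R); split => [i||]; first by rewrite ler0n.
  rewrite (bigD1 k) //= eqxx big1 ?addr0 // => i /negbTE ->; by [].
rewrite (bigD1 k) //= eqxx scale1r big1 ?addr0 // => i /negbTE ->.
by rewrite scale0r.
Qed.

Lemma region_vtx i : region P (vtx i).
Proof. by have [k ->] := vtx_ord i; exact: region_vertex. Qed.

Lemma region_orient_ge0 p q x :
  (forall l, 0 <= orient p q (vtx l)) -> region P x -> 0 <= orient p q x.
Proof.
move=> h [w [w0 w1 ->]]; rewrite orient_sum //; apply: sumr_ge0 => i _.
by rewrite mulr_ge0 // vertexE.
Qed.

Lemma side_height_ge0 i x : region P x -> 0 <= side_height i x.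
Proof. by apply: region_orient_ge0 => l; exact: side_height_vtx_ge0. Qed.

End Polygon.

(** * The symmetries of the polygon *)

Section Symmetry.
Context {R : realType} {m : nat} (hm : (3 <= m)%N) (P : regular_polygon R m).
Implicit Types (p q x y z : R * R) (i j k l : int) (e f : bool) (s t : R).

Let m0 : (m%:R : R) != 0.
Proof. by rewrite pnatr_eq0; lia. Qed.

Let r0 := radius_gt0 P.
Let rn0 : radius P != 0.
Proof. exact: lt0r_neq0. Qed.

Definition angle l : R := 2 * (phase P / 2 - pi / m%:R * l%:~R).

Lemma vtxE l : vtx P l = ((center P).1 + radius P * cos (angle l),
  (center P).2 + radius P * sin (angle l)).
Proof. by []. Qed.

Let sin1b : sin (pi / m%:R) != 0 :> R.
Proof.
by rewrite -[pi / _]mulr1 lt0r_neq0 // -[1]/(1%:~R); apply: sin_frac_gt0; lia.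
Qed.

Let m1b : m%:R * (pi / m%:R) = pi * 1%:~R :> R.
Proof. by rewrite mulrC divfK ?mulr1. Qed.

Lemma sum_cos_angle : \sum_(a < m) cos (angle a%:Z) = 0.
Proof.
rewrite -[RHS](sum_cos_progression (phase P) sin1b m1b).
by apply: eq_bigr => a _; congr cos; rewrite /angle -pmulrn; field.
Qed.

Lemma sum_sin_angle : \sum_(a < m) sin (angle a%:Z) = 0.
Proof.
rewrite -[RHS](sum_sin_progression (phase P) sin1b m1b).
by apply: eq_bigr => a _; congr sin; rewrite /angle -pmulrn; field.
Qed.

Let sin2b : sin (2 * (pi / m%:R)) != 0 :> R.
Proof.
by rewrite mulrC lt0r_neq0 // -[2]/(2%:~R); apply: sin_frac_gt0; lia.
Qed.

Let m2b : m%:R * (2 * (pi / m%:R)) = pi * 2%:~R :> R.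
Proof. by rewrite -[2%:~R]/(2 : R); field. Qed.

Lemma sum_cos2_angle : \sum_(a < m) cos (angle a%:Z) ^+ 2 = m%:R / 2.
Proof.
transitivity (\sum_(a < m) (2^-1 + cos (2 * phase P - 2 * a%:R * (2 * (pi / m%:R))) / 2)).
  apply: eq_bigr => a _.
  have -> : 2 * phase P - 2 * a%:R * (2 * (pi / m%:R)) = 2 * angle a%:Z.
    by rewrite /angle -pmulrn; field.
  by rewrite cos_double sin2cos2; field.
rewrite big_split /= -mulr_suml (sum_cos_progression _ sin2b m2b).
by rewrite mul0r addr0 sumr_const card_ord -[_ *+ m]mulr_natl.
Qed.

Lemma sum_sin2_angle : \sum_(a < m) sin (angle a%:Z) ^+ 2 = m%:R / 2.
Proof.
under eq_bigr do rewrite sin2cos2.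
rewrite sumrB sum_cos2_angle sumr_const card_ord.
by have -> : (1 *+ m : R) = m%:R by []; field.
Qed.

Lemma sum_cossin_angle : \sum_(a < m) cos (angle a%:Z) * sin (angle a%:Z) = 0.
Proof.
transitivity (\sum_(a < m) (sin (2 * phase P - 2 * a%:R * (2 * (pi / m%:R))) / 2)).
  apply: eq_bigr => a _.
  have -> : 2 * phase P - 2 * a%:R * (2 * (pi / m%:R)) = 2 * angle a%:Z.
    by rewrite /angle -pmulrn; field.
  by rewrite sin_double; field.
by rewrite -mulr_suml (sum_sin_progression _ sin2b m2b) mul0r.
Qed.

(** Let e_a be the unit vector towards vertex a. Since the e_a sum to 0 and the
e_a e_a^T sum to m / 2 times the identity, the weights
1 / m + (2 / (m r)) <x - O, e_a> represent x as a combination of the vertices;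
near the centre O they are positive. *)
Lemma region_near_center x : `|x.1 - (center P).1| <= radius P / 4 ->
  `|x.2 - (center P).2| <= radius P / 4 -> region P x.
Proof.
set a := x.1 - _; set b := x.2 - _ => ha hb.
exists (fun i : 'I_m => m%:R^-1 + 2 / (m%:R * radius P) *
  (a * cos (angle i%:Z) + b * sin (angle i%:Z))).
have mpos : 0 < (m%:R : R) by rewrite ltr0n; lia.
split.
- move=> i.
  have h1 : `|a * cos (angle i%:Z)| <= radius P / 4.
    by rewrite normrM -[leRHS]mulr1 ler_pM // cos_max.
  have h2 : `|b * sin (angle i%:Z)| <= radius P / 4.
    by rewrite normrM -[leRHS]mulr1 ler_pM // sin_max.
  have -> : m%:R^-1 = 2 / (m%:R * radius P) * (radius P / 2) by field; rewrite ?m0 ?rn0.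
  rewrite -mulrDr mulr_ge0 //; first by rewrite divr_ge0 // mulr_ge0 // ltW.
  move: h1 h2; rewrite !ler_norml => /andP[h1 _] /andP[h2 _]; lra.
- rewrite big_split /= -mulr_sumr big_split /= -!mulr_sumr sum_cos_angle sum_sin_angle.
  by rewrite sumr_const card_ord -[_ *+ m]mulr_natl; field; rewrite ?m0 ?rn0.
- rewrite [LHS]surjective_pairing [RHS]surjective_pairing sum_fst sum_snd.
  congr pair.
  + transitivity (\sum_(i < m) ((m%:R^-1 * (center P).1
      + m%:R^-1 * radius P * cos (angle i%:Z))
      + (2 / (m%:R * radius P) * (center P).1 * a * cos (angle i%:Z)
       + (2 / (m%:R * radius P) * (center P).1 * b * sin (angle i%:Z)
       + (2 / (m%:R * radius P) * radius P * a * cos (angle i%:Z) ^+ 2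
       + 2 / (m%:R * radius P) * radius P * b * (cos (angle i%:Z) * sin (angle i%:Z))))))).
      rewrite !big_split /= -!mulr_sumr sum_cos_angle sum_sin_angle sum_cos2_angle
        sum_cossin_angle sumr_const card_ord -[_ *+ m]mulr_natl /a.
      by field; rewrite ?m0 ?rn0.
    by apply: eq_bigr => i _; rewrite (vertexE hm) vtxE /=; ring.
  + transitivity (\sum_(i < m) ((m%:R^-1 * (center P).2
      + m%:R^-1 * radius P * sin (angle i%:Z))
      + (2 / (m%:R * radius P) * (center P).2 * a * cos (angle i%:Z)
       + (2 / (m%:R * radius P) * (center P).2 * b * sin (angle i%:Z)
       + (2 / (m%:R * radius P) * radius P * b * sin (angle i%:Z) ^+ 2
       + 2 / (m%:R * radius P) * radius P * a * (cos (angle i%:Z) * sin (angle i%:Z))))))).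
      rewrite !big_split /= -!mulr_sumr sum_cos_angle sum_sin_angle sum_sin2_angle
        sum_cossin_angle sumr_const card_ord -[_ *+ m]mulr_natl /b.
      by field; rewrite ?m0 ?rn0.
    by apply: eq_bigr => i _; rewrite (vertexE hm) vtxE /=; ring.
Qed.

Lemma region_center : region P (center P).
Proof. by apply: region_near_center; rewrite subrr normr0 divr_ge0 // ltW. Qed.

Lemma region_nbhs_center : nbhs (center P) (region P).
Proof.
have r4 : 0 < radius P / 4 by rewrite divr_gt0.
exists (ball (center P).1 (radius P / 4), ball (center P).2 (radius P / 4)).
  by split; exact: nbhsx_ballx.
move=> x [] /= h1 h2; apply: region_near_center; rewrite distrC ltW //.
Qed.

(** The rotation that sends vertex l to vertex l + k. *)
Definition turn k := rotation (center P) (- (2 * (pi / m%:R * k%:~R))).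
(** The reflection that sends vertex l to vertex k - l. *)
Definition flip k := reflection (center P) (2 * (phase P - pi / m%:R * k%:~R)).

Lemma turn_vtx k l : turn k (vtx P l) = vtx P (l + k).
Proof.
rewrite /turn /rotation !vtxE /=.
have -> : angle (l + k) = - (2 * (pi / m%:R * k%:~R)) + angle l.
  by rewrite /angle intrD; ring.
by rewrite cosD sinD; congr pair; ring.
Qed.

Lemma flip_vtx k l : flip k (vtx P l) = vtx P (k - l).
Proof.
rewrite /flip /reflection !vtxE /=.
have -> : angle (k - l) = 2 * (phase P - pi / m%:R * k%:~R) - angle l.
  by rewrite /angle intrB; field.
by rewrite cosB sinB; congr pair; ring.
Qed.

Lemma rotation_comb o a x y t : rotation o a ((1 - t) *: x + t *: y)
  = (1 - t) *: rotation o a x + t *: rotation o a y.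
Proof.
rewrite [RHS]surjective_pairing /rotation /= /GRing.scale /=; congr pair; ring.
Qed.

Lemma reflection_comb o a x y t : reflection o a ((1 - t) *: x + t *: y)
  = (1 - t) *: reflection o a x + t *: reflection o a y.
Proof.
rewrite [RHS]surjective_pairing /reflection /= /GRing.scale /=; congr pair; ring.
Qed.

Lemma turn_side_point k i e s : turn k (side_point P i e s) = side_point P (i + k) e s.
Proof.
rewrite /side_point; case: e; last exact: turn_vtx.
by rewrite /turn rotation_comb -/(turn k) !turn_vtx addrAC.
Qed.

(** A reflection runs the boundary backwards: the side from l to l + 1 becomes the
side from k - l - 1 to k - l, and the ratio s becomes 1 - s. *)
Lemma flip_side_point k i e s :
  flip k (side_point P i e s) = side_point P (k - i - e%:Z) e (1 - s).
Proof.
rewrite /side_point; case: e; last by rewrite flip_vtx subr0.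
rewrite /flip reflection_comb -/(flip k) !flip_vtx subKr addrC.
by congr (_ *: vtx P _ + _ *: vtx P _); lia.
Qed.

Lemma affine_sum n (w u v : 'I_n -> R) (a b c : R) : \sum_d w d = 1 ->
  a + b * (\sum_d w d * u d) + c * (\sum_d w d * v d)
  = \sum_d w d * (a + b * u d + c * v d).
Proof.
move=> w1; rewrite -[a in LHS]mul1r -w1 mulr_suml !mulr_sumr -!big_split /=.
by apply: eq_bigr => d _; ring.
Qed.

Lemma rotation_sum n (w : 'I_n -> R) (v : 'I_n -> R * R) o a :
  \sum_b w b = 1 ->
  rotation o a (\sum_b w b *: v b) = \sum_b w b *: rotation o a (v b).
Proof.
move=> w1; rewrite [RHS]surjective_pairing !sum_fst !sum_snd /rotation /=.
rewrite !sum_fst !sum_snd; congr pair.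
  transitivity ((o.1 - cos a * o.1 + sin a * o.2)
    + cos a * (\sum_b w b * (v b).1) + (- sin a) * (\sum_b w b * (v b).2)); first by ring.
  by rewrite affine_sum //; apply: eq_bigr => d _; ring.
transitivity ((o.2 - sin a * o.1 - cos a * o.2)
  + sin a * (\sum_b w b * (v b).1) + cos a * (\sum_b w b * (v b).2)); first by ring.
by rewrite affine_sum //; apply: eq_bigr => d _; ring.
Qed.

Lemma reflection_sum n (w : 'I_n -> R) (v : 'I_n -> R * R) o a :
  \sum_b w b = 1 ->
  reflection o a (\sum_b w b *: v b) = \sum_b w b *: reflection o a (v b).
Proof.
move=> w1; rewrite [RHS]surjective_pairing !sum_fst !sum_snd /reflection /=.
rewrite !sum_fst !sum_snd; congr pair.
  transitivity ((o.1 - cos a * o.1 - sin a * o.2)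
    + cos a * (\sum_b w b * (v b).1) + sin a * (\sum_b w b * (v b).2)); first by ring.
  by rewrite affine_sum //; apply: eq_bigr => d _; ring.
transitivity ((o.2 - sin a * o.1 + cos a * o.2)
  + sin a * (\sum_b w b * (v b).1) + (- cos a) * (\sum_b w b * (v b).2)); first by ring.
by rewrite affine_sum //; apply: eq_bigr => d _; ring.
Qed.

Lemma turn_region k x : region P x -> region P (turn k x).
Proof.
move=> [w [w0 w1 ->]]; rewrite /turn rotation_sum //; apply: region_conv => // b.
by rewrite -/(turn k) (vertexE hm) turn_vtx; exact: region_vtx.
Qed.

Lemma flip_region k x : region P x -> region P (flip k x).
Proof.
move=> [w [w0 w1 ->]]; rewrite /flip reflection_sum //; apply: region_conv => // b.
by rewrite -/(flip k) (vertexE hm) flip_vtx; exact: region_vtx.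
Qed.

Lemma turnK k x : turn k (turn (- k) x) = x.
Proof.
rewrite /turn /rotation /= mulrNz !(mulrN, opprK) cosN sinN.
set c := 2 * _; have h := cos2Dsin2 c.
rewrite [RHS]surjective_pairing; congr pair.
  transitivity ((center P).1 + (cos c ^+ 2 + sin c ^+ 2) * (x.1 - (center P).1)); first by ring.
  by rewrite h; ring.
transitivity ((center P).2 + (cos c ^+ 2 + sin c ^+ 2) * (x.2 - (center P).2)); first by ring.
by rewrite h; ring.
Qed.

Lemma flipK k x : flip k (flip k x) = x.
Proof.
rewrite /flip /reflection /=.
set c := 2 * _; have h := cos2Dsin2 c.
rewrite [RHS]surjective_pairing; congr pair.
  transitivity ((center P).1 + (cos c ^+ 2 + sin c ^+ 2) * (x.1 - (center P).1)); first by ring.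
  by rewrite h; ring.
transitivity ((center P).2 + (cos c ^+ 2 + sin c ^+ 2) * (x.2 - (center P).2)); first by ring.
by rewrite h; ring.
Qed.

Lemma turn_symmetry k : symmetry P (turn k).
Proof.
split; first by exists (- (2 * (pi / m%:R * k%:~R))); left.
apply/seteqP; split => [_ [x xP <-]|x xP]; first exact: turn_region.
by exists (turn (- k) x); [exact: turn_region|exact: turnK].
Qed.

Lemma flip_symmetry k : symmetry P (flip k).
Proof.
split; first by exists (2 * (phase P - pi / m%:R * k%:~R)); right.
apply/seteqP; split => [_ [x xP <-]|x xP]; first exact: flip_region.
by exists (flip k x); [exact: flip_region|exact: flipK].
Qed.

(** The point is a weighted mean of vertices, and its scalar product with its own
direction is the mean of the numbers cos (a - angle b), which are at most 1.
This mean is 1, so every vertex of positive weight has that direction. *)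
Lemma region_circumcircle a :
  region P ((center P).1 + radius P * cos a, (center P).2 + radius P * sin a) ->
  exists k, cos a = cos (angle k) /\ sin a = sin (angle k).
Proof.
move=> [w [w0 w1 xE]].
move: (congr1 fst xE) (congr1 snd xE); rewrite sum_fst sum_snd.
under eq_bigr do rewrite (vertexE hm) vtxE.
under [in X in _ -> X -> _]eq_bigr do rewrite (vertexE hm) vtxE.
rewrite /= => e1 e2.
have r1 : cos a = \sum_b w b * cos (angle b%:Z).
  apply: (mulfI rn0); rewrite mulr_sumr; apply: (addrI (center P).1).
  rewrite e1 -[(center P).1 in RHS]mul1r -w1 mulr_suml -big_split /=.
  by apply: eq_bigr => b _; ring.
have r2 : sin a = \sum_b w b * sin (angle b%:Z).
  apply: (mulfI rn0); rewrite mulr_sumr; apply: (addrI (center P).2).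
  rewrite e2 -[(center P).2 in RHS]mul1r -w1 mulr_suml -big_split /=.
  by apply: eq_bigr => b _; ring.
have h0 : \sum_b w b * (1 - cos (a - angle b%:Z)) = 0.
  transitivity (\sum_b w b - cos a * \sum_b w b * cos (angle b%:Z)
      - sin a * \sum_b w b * sin (angle b%:Z)).
    rewrite !mulr_sumr -!sumrB; apply: eq_bigr => b _; rewrite cosB; ring.
  by rewrite -r1 -r2 w1; have := cos2Dsin2 a; rewrite !expr2; lra.
have h b : 0 <= w b * (1 - cos (a - angle b%:Z)).
  by rewrite mulr_ge0 // subr_ge0 cos_le1.
have [b wb] : exists b, w b != 0.
  apply: contrapT => /forallNP hw; move: w1; rewrite big1.
    by move=> /eqP; rewrite eq_sym oner_eq0.
  by move=> b _; apply/eqP/negPn/negP; exact: hw.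
exists b%:Z; apply: cos_eq1_angle; apply/eqP; rewrite eq_sym -subr_eq0.
move: h0 => /eqP; rewrite psumr_eq0 // => /allP /(_ b (mem_index_enum b)) /=.
by rewrite mulf_eq0 (negbTE wb).
Qed.

(** The image of vertex 0 has the same distance from the centre, so it is a
vertex k, and this determines the angle of the rotation or reflection. *)
Lemma symmetryP g : symmetry P g <-> exists k, g = turn k \/ g = flip k.
Proof.
split=> [[[a gE] gP]|[k [->|->]]]; [|exact: turn_symmetry|exact: flip_symmetry].
have : region P (g (vtx P 0)) by rewrite -gP; exists (vtx P 0) => //; exact: region_vtx.
have a0 : angle 0 = phase P by rewrite /angle; field.
case: gE => gE; rewrite gE vtxE a0.
  have -> : rotation (center P) a ((center P).1 + radius P * cos (phase P),
      (center P).2 + radius P * sin (phase P))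
    = ((center P).1 + radius P * cos (a + phase P),
       (center P).2 + radius P * sin (a + phase P)).
    by rewrite /rotation /= cosD sinD; congr pair; ring.
  move=> /region_circumcircle[k [ck sk]]; exists k; left; rewrite /turn.
  have ka : - (2 * (pi / m%:R * k%:~R)) = angle k - phase P by rewrite /angle; field.
  have ea : a = (a + phase P) - phase P by ring.
  have ca : cos a = cos (- (2 * (pi / m%:R * k%:~R))) by rewrite ka cosB -ck -sk -cosB -ea.
  have sa : sin a = sin (- (2 * (pi / m%:R * k%:~R))) by rewrite ka sinB -ck -sk -sinB -ea.
  by apply/funext => x; rewrite /rotation ca sa.
have -> : reflection (center P) a ((center P).1 + radius P * cos (phase P),
    (center P).2 + radius P * sin (phase P))
  = ((center P).1 + radius P * cos (a - phase P),
     (center P).2 + radius P * sin (a - phase P)).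
  by rewrite /reflection /= cosB sinB; congr pair; ring.
move=> /region_circumcircle[k [ck sk]]; exists k; right; rewrite /flip.
have ka : 2 * (phase P - pi / m%:R * k%:~R) = angle k + phase P by rewrite /angle; field.
have ea : a = (a - phase P) + phase P by ring.
have ca : cos a = cos (2 * (phase P - pi / m%:R * k%:~R)) by rewrite ka cosD -ck -sk -cosD -ea.
have sa : sin a = sin (2 * (phase P - pi / m%:R * k%:~R)) by rewrite ka sinD -ck -sk -sinD -ea.
by apply/funext => x; rewrite /reflection ca sa.
Qed.

End Symmetry.

(** * The pieces of a chord *)

Section Cuts.
Context {R : realType} {m : nat} (hm : (3 <= m)%N) (P : regular_polygon R m).
Implicit Types (p q x y z : R * R) (i j k l : int) (e f : bool) (s t : R).

Let r0 := radius_gt0 P.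

(** The part of the polygon strictly to the left of the line from p to q. With p
and q exchanged this is the opposite part, so that one definition serves for
both sides of a chord. *)
Definition half_region p q : set (R * R) := region P `&` [set x | orient p q x < 0].

Lemma half_swapE p q x : half_region q p x <-> region P x /\ 0 < orient p q x.
Proof. by rewrite /half_region /= orient_swap oppr_lt0. Qed.

Lemma half_convex p q : convex_set (half_region p q).
Proof.
move=> x y t [xP hx] [yP hy] t01; split; first exact: region_convex.
move: hx hy t01; rewrite /= orient_comb => hx hy /andP[t0 t1].
have [->|t1'] := eqVneq t 1; first by rewrite subrr mul0r add0r mul1r.
have t1'' : 0 < 1 - t by rewrite subr_gt0 lt_neqAle t1'.
rewrite -oppr_gt0 opprD ltr_wpDr // -mulrN ?mulr_ge0 ?mulr_gt0 ?oppr_gt0 //.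
by rewrite oppr_ge0 ltW.
Qed.

Lemma half_connected p q : connected (half_region p q).
Proof.
have [->|/set0P[x hx]] := eqVneq (half_region p q) set0; first exact: connected0.
by apply: (starshaped_connected hx) => y t hy; exact: half_convex.
Qed.

Lemma orient_on_segment p q x : segment p q x -> orient p q x = 0.
Proof. by move=> [t _ <-]; rewrite orient_comb /orient; ring. Qed.

(** The chord is all of what its line has in common with the polygon, and
therefore separates it. *)
Definition full_chord p q :=
  forall x, region P x -> orient p q x = 0 -> segment p q x.

Lemma full_chord_swap p q : full_chord p q -> full_chord q p.
Proof.
move=> h x xP; rewrite orient_swap => /eqP; rewrite oppr_eq0 => /eqP /(h x xP).
move=> [t t01 <-]; exists (1 - t); last by rewrite subKr addrC.
by move: t01; rewrite /= !in_itv /=; lra.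
Qed.

Lemma segment_swap p q : segment p q = segment q p.
Proof.
by apply/seteqP; split=> x [t]; rewrite /= in_itv /= => t01 <-;
  (exists (1 - t); [rewrite /= in_itv /=; lra | rewrite subKr addrC]).
Qed.

Lemma regionDchord p q : full_chord p q ->
  region P `\` segment p q = half_region p q `|` half_region q p.
Proof.
move=> h; apply/seteqP; split=> [x [xP xn]|x [|]].
- have [lt0|gt0|eq0] := ltgtP (orient p q x) 0.
  + by left.
  + by right; apply/half_swapE.
  + by case: xn; exact: h.
- by move=> [xP /= o0]; split => // /orient_on_segment o0'; rewrite o0' ltxx in o0.
- by move=> /half_swapE [xP o0]; split => // /orient_on_segment o0'; rewrite o0' ltxx in o0.
Qed.

(** A connected set that avoids the chord cannot cross its line, because on it the
orientation is continuous and does not vanish. *)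
Lemma half_component p q x : full_chord p q -> half_region p q x ->
  connected_component (region P `\` segment p q) x = half_region p q.
Proof.
move=> h hx; apply/seteqP; split => [y [B [Bx BA Bc] By]|].
  have hpos : forall y, B y -> 0 < - orient p q y.
    apply: (connected_nonvanishing_gt0 (x := x)) => //.
    - by move=> z; apply: cvgN; exact: continuous_orient.
    - move=> z /BA; rewrite regionDchord // oppr_eq0 => -[[_ /= /lt_eqF ->]//|].
      by move=> /half_swapE[_ /gt_eqF ->].
    - by rewrite oppr_gt0; case: hx.
  by move: (hpos y By); rewrite oppr_gt0; split => //; have [] := BA _ By.
apply: connected_component_max => //; last exact: half_connected.
by rewrite regionDchord // => y; left.
Qed.

Lemma pieces_full_chord p q : full_chord p q -> half_region p q !=set0 ->
  half_region q p !=set0 -> pieces P (p, q) = [set half_region p q; half_region q p].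
Proof.
move=> h [x hx] [y hy]; rewrite /pieces /chord_set /=; apply/seteqP; split.
  move=> _ [z + <-]; rewrite {1}regionDchord // => -[hz|hz].
    by left; exact: half_component.
  right; rewrite segment_swap; apply: half_component => //.
  exact: full_chord_swap.
move=> _ [->|->].
  exists x; [by rewrite regionDchord //; left|exact: half_component].
exists y; first by rewrite regionDchord //; right.
rewrite segment_swap; apply: half_component => //; exact: full_chord_swap.
Qed.

Lemma half_disjoint p q x : half_region p q x -> half_region q p x -> False.
Proof.
by move=> [_ /= h1] /half_swapE[_ h2]; move: (lt_trans h1 h2); rewrite ltxx.
Qed.

Lemma card_set_pair T (A B : T) : A <> B -> ([set A; B] #= `I_2)%card.
Proof.
move=> AB.
have -> : [set A; B] = (fun n => if n == 0%N then A else B) @` `I_2.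
  apply/seteqP; split=> [_ [->|->]|_ [[|n] _ <-]] /=; [by exists 0%N|by exists 1%N|by left|by right].
apply: inj_card_eq => -[|[|a]] [|[|b]]; rewrite ?inE //= => _ _ // h.
by case: AB.
Qed.

(** The homothetic images of a square about the centre, contracted towards a point
x of the half, lie in the polygon, and in the half once they are close enough
to x. *)
Lemma half_area_gt0 p q : half_region p q !=set0 -> (0 < area (half_region p q))%E.
Proof.
move=> [x [xP /= ox]].
set g := - orient p q x.
have g0 : 0 < g by rewrite oppr_gt0.
(* A bound for the orientation on the square. *)
set B := `|orient p q (center P)|
  + (`|q.2 - p.2| + `|q.1 - p.1|) * (radius P / 4).
have B0 : 0 <= B by rewrite addr_ge0 // mulr_ge0 ?addr_ge0 // divr_ge0 // ltW.
have ob y : `|y.1 - (center P).1| <= radius P / 4 ->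
    `|y.2 - (center P).2| <= radius P / 4 -> orient p q y <= B.
  move=> y1 y2.
  have -> : orient p q y = orient p q (center P)
      + ((q.2 - p.2) * (y.1 - (center P).1) - (q.1 - p.1) * (y.2 - (center P).2)).
    by rewrite /orient; ring.
  apply: lerD; first exact: ler_norm.
  apply: le_trans (ler_norm _) _; apply: le_trans (ler_normB _ _) _.
  by rewrite [leRHS]mulrDl !normrM lerD // ler_wpM2l.
set l := g / (B + g + 1).
have d0 : 0 < B + g + 1 by lra.
have l0 : 0 < l by rewrite divr_gt0.
have l1 : l < 1 by rewrite ltr_pdivrMr // mul1r; lra.
have lg : l * (B + g) < g.
  rewrite /l mulrAC ltr_pdivrMr // ltr_pM2l //; lra.
pose c : R * R := (1 - l) *: x + l *: center P.
have lr : 0 < l * (radius P / 4) by rewrite mulr_gt0 // divr_gt0.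
apply: (@area_box_gt0 R (c.1 - l * (radius P / 4)) (c.1 + l * (radius P / 4))
  (c.2 - l * (radius P / 4)) (c.2 + l * (radius P / 4))); [lra|lra|].
move=> z hz1 hz2.
pose y := l^-1 *: (z - (1 - l) *: x).
have zE : z = (1 - l) *: x + l *: y.
  by rewrite /y scalerA divff ?lt0r_neq0 // scale1r subrKC.
have aux (z1 x1 o1 : R) : (1 - l) * x1 + l * o1 - l * (radius P / 4) < z1
     < (1 - l) * x1 + l * o1 + l * (radius P / 4) ->
   `|l^-1 * (z1 - (1 - l) * x1) - o1| <= radius P / 4.
  move=> hz; rewrite -(ler_pM2l l0) -[X in X * `|_|]gtr0_norm // -normrM.
  rewrite mulrBr mulVKf ?lt0r_neq0 // ler_norml; lra.
have y1 : `|y.1 - (center P).1| <= radius P / 4 by exact: aux.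
have y2 : `|y.2 - (center P).2| <= radius P / 4 by exact: aux.
rewrite zE; split.
  by apply: region_convex => //; [exact: region_near_center|rewrite !ltW].
rewrite /= orient_comb.
have : l * orient p q y <= l * B by rewrite ler_pM2l // ob.
by rewrite -[orient p q x]opprK -/g; lra.
Qed.

Lemma full_chord_is_cut p q : boundary P p -> boundary P q -> full_chord p q ->
  half_region p q !=set0 -> half_region q p !=set0 -> is_cut P (p, q).
Proof.
move=> bp bq h n1 n2; split => //; rewrite pieces_full_chord //.
  apply: card_set_pair => E; case: n1 => x hx.
  by apply: (half_disjoint hx); rewrite -E.
by move=> _ [->|->]; exact: half_area_gt0.
Qed.

Lemma side_cases (k : nat) x : side P k x ->
  x = vtx P k%:Z \/ x = vtx P (k%:Z + 1) \/ exists2 s, 0 < s < 1 & x = side_point P k%:Z true s.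
Proof.
rewrite /side !vertexE // -addn1 PoszD => -[s]; rewrite /= in_itv /= => /andP[s0 s1] <-.
have [->|s0'] := eqVneq s 0; first by left; rewrite subr0 scale1r scale0r addr0.
have [->|s1'] := eqVneq s 1; first by right; left; rewrite subrr scale1r scale0r add0r.
right; right; exists s => //; lra.
Qed.

Lemma side_height_side (k : nat) x : side P k x -> side_height P k%:Z x = 0.
Proof.
rewrite /side !vertexE // -addn1 PoszD => -[s _ <-].
by rewrite /side_height orient_comb /orient; ring.
Qed.

(** Were the height 0, a point slightly beyond the centre as seen from vertex
l + 2 would have negative height, although it still lies in the polygon. *)
Lemma side_height_center l : 0 < side_height P l (center P).
Proof.
have := side_height_ge0 hm l (region_center hm P).
rewrite le_eqVlt => /orP[/eqP /esym h0|//]; exfalso.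
pose x : R * R := (1 + radius P / 4 / radius P) *: center P
   - (radius P / 4 / radius P) *: vtx P (l + 2).
have rn0 : radius P != 0 by exact: lt0r_neq0.
have xP : region P x.
  apply: region_near_center => //.
    have -> : x.1 - (center P).1 = radius P / 4 * (- cos (angle P (l + 2))).
      by rewrite /x vtxE /= /GRing.scale /=; field.
    rewrite normrM normrN -[leRHS]mulr1 ler_pM // ?cos_max // ger0_norm //.
    by rewrite divr_ge0 // ltW.
  have -> : x.2 - (center P).2 = radius P / 4 * (- sin (angle P (l + 2))).
    by rewrite /x vtxE /= /GRing.scale /=; field.
  rewrite normrM normrN -[leRHS]mulr1 ler_pM // ?sin_max // ger0_norm //.
  by rewrite divr_ge0 // ltW.
have := side_height_ge0 hm l xP.
have -> : side_height P l x = (1 + radius P / 4 / radius P) * side_height P l (center P)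
   - (radius P / 4 / radius P) * side_height P l (vtx P (l + 2)).
  by rewrite /side_height /orient /x /= /GRing.scale /=; field.
have v0 : 0 < side_height P l (vtx P (l + 2)).
  by apply: orient_vtx_gt0 => //; lia.
rewrite h0 mulr0 sub0r oppr_ge0 => h1.
have : 0 < radius P / 4 / radius P * side_height P l (vtx P (l + 2)).
  by rewrite mulr_gt0 // !divr_gt0.
by rewrite ltNge h1.
Qed.

(** The chord lies on a side line, which the segments from the centre reach only
at their ends: what remains of the polygon is star-shaped about the centre. *)
Lemma common_side_not_cut (k : nat) p q : side P k p -> side P k q ->
  ~ is_cut P (p, q).
Proof.
move=> kp kq [_ _ + _].
have hc x : segment p q x -> side_height P k%:Z x = 0.
  move=> [t _ <-]; rewrite /side_height orient_comb.
  move: (side_height_side kp) (side_height_side kq); rewrite /side_height => -> ->.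
  ring.
have cA : connected (region P `\` segment p q).
  have cP := side_height_center k%:Z.
  apply: (@starshaped_connected R _ (center P)).
    by split; [exact: region_center|move=> /hc h; rewrite h ltxx in cP].
  move=> x t [xP xn] t01; split; first by apply: region_convex => //; exact: region_center.
  have [->|t1] := eqVneq t 1; first by rewrite subrr scale0r scale1r add0r.
  move=> /hc; rewrite /side_height orient_comb -!/(side_height _ _ _) => /eqP.
  rewrite gt_eqF //; apply: ltr_wpDr.
    by rewrite mulr_ge0 ?side_height_ge0 //; case/andP: t01.
  by rewrite mulr_gt0 // subr_gt0 lt_neqAle t1; case/andP: t01.
have sub : pieces P (p, q) `<=` [set region P `\` segment p q].
  by move=> _ [x xA <-]; exact: connected_component_id.
move=> c2; have := subset_card_le sub.
rewrite (card_le_eql c2) (card_le_eqr card_set1) card_le_II; lia.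
Qed.

End Cuts.

(** * Cells of the boundary *)

Section Cells.
Context (m : nat).
Implicit Types (i j k l : int) (e f : bool).

(** The flag e tells the side after vertex i from the vertex itself. *)
Definition cell i e : int := 2 * i + e%:Z.

(** The two cells lie on no common closed side. Seen from a side, this is distance
at least 2 both ways round; but two vertices at distance 2 are the ends of one
side. *)
Definition separated i e j f : bool :=
  let d := cell j f - cell i e in
  [&& 2 <= d, d <= 2 * m%:Z - 2 & [|| e, f | (4 <= d) && (d <= 2 * m%:Z - 4)]].

Lemma separated_swap i e j f :
  separated i e j f = separated j f (i + 1 * m%:Z) e.
Proof. by rewrite /separated /cell; apply/idP/idP; case: e f => -[] /=; lia. Qed.

Lemma separated_between i e j f : separated i e j f ->
  cell i e < 2 * (i + 1) < cell j f.
Proof. by rewrite /separated /cell; case: e f => -[] /=; lia. Qed.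

Lemma separated_turn i e j f k :
  separated (i + k) e (j + k) f = separated i e j f.
Proof. by rewrite /separated /cell; apply/idP/idP; case: e f => -[] /=; lia. Qed.

Lemma separated_flip i e j f k :
  separated (k - j - f%:Z) f (k - i - e%:Z) e = separated i e j f.
Proof. by rewrite /separated /cell; apply/idP/idP; case: e f => -[] /=; lia. Qed.

(** Equality of cells modulo a full turn. *)
Definition same_cell i e j f := e = f /\ exists k, j = i + k * m%:Z.

Lemma same_cell_sym i e j f : same_cell i e j f -> same_cell j f i e.
Proof. by move=> [-> [k ->]]; split=> //; exists (- k); rewrite mulNr addrK. Qed.

Lemma same_cell_trans i e j f k g : same_cell i e j f -> same_cell j f k g ->
  same_cell i e k g.
Proof.
by move=> [-> [a ->]] [-> [b ->]]; split=> //; exists (a + b); rewrite mulrDl addrA.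
Qed.

(** The cell (a, b) contains an endpoint of a chord between the cells (i, e) and
(j, f). *)
Definition meets_cell i e j f a b := same_cell i e a b \/ same_cell j f a b.

Lemma int_ord i : (3 <= m)%N -> exists a : 'I_m, exists k, i = (a : nat)%:Z + k * m%:Z.
Proof.
move=> hm; have n0 : 0 <= (i %% m%:Z)%Z by rewrite modz_ge0; lia.
have nm : (i %% m%:Z)%Z < m%:Z by rewrite ltz_pmod; lia.
have lt : (`|(i %% m%:Z)%Z| < m)%N by lia.
exists (Ordinal lt), (i %/ m%:Z)%Z => /=; have := divz_eq i m; lia.
Qed.

Lemma separated_not_same i e j f : separated i e j f -> ~ same_cell i e j f.
Proof.
rewrite /separated /cell => /and3P[h1 h2 _] [ef [k jk]]; move: h1 h2; rewrite ef jk.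
by have [k0|k0] := lerP k 0; nia.
Qed.

Lemma separated_not_both i e j f (a : int) : separated i e j f ->
  same_cell i e a true -> same_cell j f a true -> False.
Proof.
move=> /separated_not_same n h1 h2; apply: n.
exact: same_cell_trans h1 (same_cell_sym h2).
Qed.

Lemma same_cell_ord (a b : 'I_m) e i f : same_cell i f (a : nat)%:Z e ->
  same_cell i f (b : nat)%:Z e -> a = b.
Proof.
move=> [_ [k ak]] [_ [k' bk]]; apply/val_inj => /=.
have := ltn_ord a; have := ltn_ord b => h1 h2.
have [h|h|h] := ltgtP k k'; nia.
Qed.

Lemma meets_match i e j f i' e' j' f' :
  separated i e j f -> separated i' e' j' f' ->
  (forall a b, meets_cell i e j f a b <-> meets_cell i' e' j' f' a b) ->
  (same_cell i e i' e' /\ same_cell j f j' f') \/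
  (same_cell i e j' f' /\ same_cell j f i' e').
Proof.
move=> /separated_not_same n1 /separated_not_same n2 h.
have rfl a b : same_cell a b a b by split=> //; exists 0; rewrite mul0r addr0.
have hi := (h i e).1 (or_introl (rfl i e)).
have hj := (h j f).1 (or_intror (rfl j f)).
case: hi => hi; case: hj => hj.
- by case: n1; apply: same_cell_trans (same_cell_sym hi) hj.
- by left; split; exact: same_cell_sym.
- by right; split; exact: same_cell_sym.
- by case: n1; apply: same_cell_trans (same_cell_sym hi) hj.
Qed.

(** Both endpoints move by the same number of turns, as the distance of separated
cells lies strictly between 0 and a full turn. *)
Lemma separated_shift i e j f i' j' :
  separated i e j f -> separated i' e j' f ->
  same_cell i e i' e -> same_cell j f j' f ->
  exists k, i' = i + k * m%:Z /\ j' = j + k * m%:Z.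
Proof.
move=> s1 s2 [_ [k ik]] [_ [k' jk]]; exists k; split=> //.
have -> // : k = k'; move: s1 s2; rewrite /separated /cell ik jk.
move=> /and3P[a1 a2 _] /and3P[b1 b2 _].
have [h|h|//] := ltgtP k k'; exfalso; nia.
Qed.

Lemma separated_shift_swap i e j f i' j' :
  separated i e j f -> separated i' f j' e ->
  same_cell i e j' e -> same_cell j f i' f ->
  exists k, i' = j + k * m%:Z /\ j' = i + (k + 1) * m%:Z.
Proof.
move=> s1; rewrite separated_swap => s2 h1 h2.
have h2' : same_cell j f i' f := h2.
have h3 : same_cell i e (j' - 1 * m%:Z) e.
  by apply: same_cell_trans h1 _; split=> //; exists (-1); lia.
have s3 : separated (j' - 1 * m%:Z) e i' f.
  by move: s2; rewrite /separated /cell; apply: etrans; congr [&& _, _ & [|| _, _ | _]]; lia.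
have [k [e1 e2]] := separated_shift s1 s3 h3 h2'.
by exists k; split; lia.
Qed.

(** The data (d, b, sg, rh) of a chord; [type_at] below computes them. *)
Definition cut_type : Type := (int * bool * int * int)%type.

(** The data of the same chord read from its other endpoint. *)
Definition swap_type (u : cut_type) : cut_type :=
  let: (d, b, sg, rh) := u in (2 * m%:Z - d, b, - sg, - rh).

Lemma swap_typeK (u : cut_type) : swap_type (swap_type u) = u.
Proof. by case: u => [[[d b] sg] rh]; rewrite /swap_type /= !opprK; congr (_, _, _, _); lia. Qed.

End Cells.

(** * Chords between two cells *)

Section CellChords.
Context {R : realType} {m : nat} (hm : (3 <= m)%N) (P : regular_polygon R m).
Implicit Types (p q x y z : R * R) (i j k l : int) (e f : bool) (s t : R).

Lemma separated_height i e j f t : separated m i e j f -> 0 < t < 1 ->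
  0 < side_height P i (side_point P j f t).
Proof.
move=> sep t01; apply: side_height_point_gt0 => //;
  by move: sep; rewrite /separated /cell; case: e f => -[] /=; lia.
Qed.

Lemma separated_height_swap i e s j f : separated m i e j f -> 0 < s < 1 ->
  0 < side_height P j (side_point P i e s).
Proof.
rewrite separated_swap => /separated_height h s01.
by rewrite -(side_pointD hm P i 1); exact: h.
Qed.

(** On a line through p that is transversal to the line ab through p, a point is
determined by its height over ab. *)
Lemma orient_point (a b p q x : R * R) : orient a b p = 0 ->
  orient p q x = 0 -> orient a b q != 0 ->
  x = (1 - orient a b x / orient a b q) *: p + (orient a b x / orient a b q) *: q.
Proof.
move=> hp hx hq.
have e1 : orient a b q * (x.1 - p.1) = orient a b x * (q.1 - p.1)
    - (b.1 - a.1) * orient p q x + orient a b p * (x.1 - q.1).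
  by rewrite /orient; ring.
have e2 : orient a b q * (x.2 - p.2) = orient a b x * (q.2 - p.2)
    - (b.2 - a.2) * orient p q x + orient a b p * (x.2 - q.2).
  by rewrite /orient; ring.
rewrite hx hp mulr0 mul0r subr0 addr0 in e1 e2.
rewrite [LHS]surjective_pairing [RHS]surjective_pairing /= /GRing.scale /=.
congr pair; apply: (mulfI hq).
  transitivity (orient a b q * (x.1 - p.1) + orient a b q * p.1); first by ring.
  by rewrite e1; field.
transitivity (orient a b q * (x.2 - p.2) + orient a b q * p.2); first by ring.
by rewrite e2; field.
Qed.

(** On the line of the chord, the side line at p bounds the polygon at p and the
side line at q bounds it at q, because the other endpoint lies strictly inside
in both cases. *)
Lemma separated_full_chord i e s j f t : 0 < s < 1 -> 0 < t < 1 ->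
  separated m i e j f -> full_chord P (side_point P i e s) (side_point P j f t).
Proof.
move=> s01 t01 sep x xP x0.
have hq := separated_height sep t01; have hp := separated_height_swap sep s01.
set p := side_point P i e s in x0 hp *; set q := side_point P j f t in x0 hq *.
have xE := orient_point (side_height_self P i e s) x0 (lt0r_neq0 hq).
rewrite -/p -!/(side_height P i _) in xE.
have x1 : 0 <= side_height P i x by exact: side_height_ge0.
have x2 : 0 <= side_height P j x by exact: side_height_ge0.
set l := side_height P i x / side_height P i q in xE.
have l0 : 0 <= l by rewrite divr_ge0 // ltW.
exists l; last by rewrite -xE.
rewrite /= in_itv /= l0 /=.
move: x2; rewrite xE /side_height orient_comb -!/(side_height _ _ _).
by rewrite (side_height_self P j f t) mulr0 addr0 pmulr_lge0 // subr_ge0.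
Qed.

(** On the polygon this vanishes only at vertex l, where two side lines meet; it
shows that the vertex is an extreme point. *)
Definition vertex_height l x := side_height P (l - 1) x + side_height P l x.

Lemma vertex_height_comb l p q t :
  vertex_height l ((1 - t) *: p + t *: q)
  = (1 - t) * vertex_height l p + t * vertex_height l q.
Proof. by rewrite /vertex_height /side_height !orient_comb; ring. Qed.

Lemma vertex_height_self l : vertex_height l (vtx P l) = 0.
Proof.
rewrite /vertex_height /side_height (_ : l - 1 + 1 = l); last by lia.
by rewrite /orient; ring.
Qed.

Lemma vertex_height_gt0 l i e s : 0 < s < 1 ->
  2 * l - 2 * m%:Z < cell i e < 2 * l -> 0 < vertex_height l (side_point P i e s).
Proof.
move=> s01; rewrite /cell => hl; rewrite /vertex_height -(side_pointD hm P i 1).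
have [h|h] := boolP (cell i e < 2 * l - 2); rewrite /cell in h.
  apply: ltr_wpDr; first exact: side_height_point_ge0.
  by apply: side_height_point_gt0 => //; case: e h hl => /=; lia.
apply: ltr_wpDl; first exact: side_height_point_ge0.
by apply: side_height_point_gt0 => //; case: e h hl => /=; lia.
Qed.

Lemma separated_vertex_neq0 i e s j f t l : 0 < s < 1 -> 0 < t < 1 ->
  separated m i e j f -> cell i e < 2 * l < cell j f ->
  orient (side_point P i e s) (side_point P j f t) (vtx P l) != 0.
Proof.
move=> s01 t01 sep lP; apply/eqP => /(separated_full_chord s01 t01 sep).
move=> /(_ (region_vtx hm P l)) [d]; rewrite /= in_itv /= => /andP[d0 d1] lE.
have vp : 0 < vertex_height l (side_point P i e s).
  by apply: vertex_height_gt0 => //; move: sep lP; rewrite /separated /cell; lia.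
have vq : 0 < vertex_height l (side_point P j f t).
  rewrite -(side_pointD hm P j (-1)); apply: vertex_height_gt0 => //.
  by move: sep lP; rewrite /separated /cell; lia.
have := vertex_height_self l; rewrite -lE vertex_height_comb => /eqP.
have [->|d0'] := eqVneq d 0; first by rewrite subr0 mul1r mul0r addr0 gt_eqF.
rewrite gt_eqF //; apply: ltr_wpDl; first by rewrite mulr_ge0 ?subr_ge0 // ltW.
by rewrite mulr_gt0 // lt_neqAle eq_sym d0'.
Qed.

(** Expanding both ends of the chord over the ends of their sides writes the
orientation as a combination of orientations of three vertices in clockwise
order, which all have the same sign; it does not vanish by
[separated_vertex_neq0]. *)
Lemma separated_vertex i e s j f t l : 0 < s < 1 -> 0 < t < 1 ->
  separated m i e j f -> cell i e < 2 * l < cell j f ->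
  half_region P (side_point P i e s) (side_point P j f t) (vtx P l).
Proof.
move=> s01 t01 sep lP; split; first exact: region_vtx.
rewrite /= lt_neqAle separated_vertex_neq0 //= -oppr_ge0 -orient_swap.
have V a b : i <= a -> a <= i + e%:Z -> j <= b -> b <= j + f%:Z ->
    0 <= orient (vtx P b) (vtx P a) (vtx P l).
  move=> a1 a2 b1 b2; rewrite orient_rot; apply: orient_vtx_ge0 => //;
  by move: sep lP a1 a2 b1 b2; rewrite /separated /cell; case: e f => -[] /=; lia.
have Vb b : j <= b -> b <= j + f%:Z -> 0 <= orient (vtx P b) (side_point P i e s) (vtx P l).
  move=> b1 b2; rewrite /side_point; case: e V {sep lP} => V; last by apply: V; lia.
  case/andP: s01 => s0 s1; rewrite -orient_rot orient_comb !(orient_rot (vtx P l)).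
  have s1' : 0 <= 1 - s by rewrite subr_ge0 ltW.
  apply: addr_ge0; apply: mulr_ge0 => //; try exact: ltW.
    by apply: V; lia.
  by apply: V; lia.
rewrite [X in orient X _ _]/side_point; case: f Vb {sep lP V} => Vb; last by apply: Vb; lia.
case/andP: t01 => t0 t1; rewrite orient_rot orient_comb -(orient_rot (vtx P j)).
rewrite -(orient_rot (vtx P (j + 1))).
have t1' : 0 <= 1 - t by rewrite subr_ge0 ltW.
apply: addr_ge0; apply: mulr_ge0 => //; try exact: ltW.
  by apply: Vb; lia.
by apply: Vb; lia.
Qed.

Lemma separated_vertex_swap i e s j f t l : 0 < s < 1 -> 0 < t < 1 ->
  separated m i e j f -> cell j f < 2 * l < cell i e + 2 * m%:Z ->
  half_region P (side_point P j f t) (side_point P i e s) (vtx P l).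
Proof.
move=> s01 t01; rewrite separated_swap => sep lP.
rewrite -(side_pointD hm P i 1); apply: separated_vertex => //.
by move: lP; rewrite /cell; lia.
Qed.

Lemma separated_half i e s j f t : 0 < s < 1 -> 0 < t < 1 ->
  separated m i e j f -> half_region P (side_point P i e s) (side_point P j f t) !=set0.
Proof.
move=> s01 t01 sep; exists (vtx P (i + 1)).
by apply: separated_vertex => //; exact: separated_between sep.
Qed.

Lemma separated_half_swap i e s j f t : 0 < s < 1 -> 0 < t < 1 ->
  separated m i e j f -> half_region P (side_point P j f t) (side_point P i e s) !=set0.
Proof.
move=> s01 t01; rewrite separated_swap => sep; rewrite -(side_pointD hm P i 1).
exact: separated_half.
Qed.

Lemma separated_pieces i e s j f t : 0 < s < 1 -> 0 < t < 1 ->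
  separated m i e j f -> pieces P (side_point P i e s, side_point P j f t)
  = [set half_region P (side_point P i e s) (side_point P j f t);
     half_region P (side_point P j f t) (side_point P i e s)].
Proof.
move=> s01 t01 sep; apply: pieces_full_chord.
- exact: separated_full_chord.
- exact: separated_half.
- exact: separated_half_swap.
Qed.

Lemma boundary_side_point i e s : 0 < s < 1 -> boundary P (side_point P i e s).
Proof.
move=> s01.
have [k kE] : exists k : 'I_m, ((k : nat)%:Z = (i %% m%:Z)%Z)%Z.
  have n0 : 0 <= (i %% m%:Z)%Z by rewrite modz_ge0; lia.
  have nm : (i %% m%:Z)%Z < m%:Z by rewrite ltz_pmod; lia.
  have lt : (`|(i %% m%:Z)%Z| < m)%N by lia.
  by exists (Ordinal lt) => /=; lia.
exists k; rewrite (divz_eq i m) addrC side_pointD // -kE /side !(vertexE hm).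
rewrite -[(k : nat).+1]addn1 PoszD /side_point; case: e.
  by exists s => //; rewrite /= in_itv /=; lra.
by exists 0; [rewrite /= in_itv /= lexx ler01|rewrite subr0 scale0r addr0 scale1r].
Qed.

Lemma separated_is_cut i e s j f t : 0 < s < 1 -> 0 < t < 1 ->
  separated m i e j f -> is_cut P (side_point P i e s, side_point P j f t).
Proof.
move=> s01 t01 sep; apply: full_chord_is_cut => //.
- exact: boundary_side_point.
- exact: boundary_side_point.
- exact: separated_full_chord.
- exact: separated_half.
- exact: separated_half_swap.
Qed.

Lemma is_cut_swap p q : is_cut P (p, q) -> is_cut P (q, p).
Proof.
have E : pieces P (q, p) = pieces P (p, q) by rewrite /pieces /chord_set /= segment_swap.
by case=> ? ? ? ?; split; rewrite ?E.
Qed.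

Let half01 : 0 < (2^-1 : R) < 1.
Proof. lra. Qed.

Lemma boundary_cell p : boundary P p -> exists i e s,
  [/\ 0 <= cell i e < 2 * m%:Z, 0 < s < 1 & p = side_point P i e s].
Proof.
move=> [k /(side_cases hm)[->|[->|[s s01 ->]]]].
- exists k%:Z, false, 2^-1; split => //; rewrite /cell /=; have := ltn_ord k; lia.
- have [km|km] := boolP ((k : nat).+1 == m).
    exists 0, false, 2^-1; split => //; first by rewrite /cell /=; lia.
    by rewrite /side_point -[RHS](vtxD hm P 0 1); congr vtx; lia.
  exists (k%:Z + 1), false, 2^-1; split => //; rewrite /cell /=; have := ltn_ord k; lia.
- exists k%:Z, true, s; split => //; rewrite /cell /=; have := ltn_ord k; lia.
Qed.

Lemma side_point_on_side (k : nat) i e s : k%:Z = i \/ ~~ e /\ k%:Z + 1 = i ->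
  0 < s < 1 -> side P k (side_point P i e s).
Proof.
move=> h s01; rewrite /side !(vertexE hm) -[k.+1]addn1 PoszD /side_point.
case: h => [->|[/negbTE -> ->]].
  case: e; first by exists s => //; rewrite /= in_itv /=; lra.
  by exists 0; [rewrite /= in_itv /= lexx ler01|rewrite subr0 scale0r addr0 scale1r].
by exists 1; [rewrite /= in_itv /= lexx ler01|rewrite subrr scale0r add0r scale1r].
Qed.

(** This and [common_side_not_cut] make separation necessary for a cut. *)
Lemma not_separated_common_side i e s j f t : 0 < s < 1 -> 0 < t < 1 ->
  0 <= cell i e -> cell i e <= cell j f < 2 * m%:Z -> ~~ separated m i e j f ->
  exists k : nat, side P k (side_point P i e s) /\ side P k (side_point P j f t).
Proof.
move=> s01 t01; rewrite /separated /cell => i0 ij nsep.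
have [h|h] := boolP (cell j f <= 2 * i + 2).
  exists `|i|%N; split; apply: side_point_on_side => //;
  by move: i0 ij nsep h; rewrite /cell; case: e f => -[] /=; lia.
(* Otherwise the side after vertex j ends at vertex i. *)
exists `|j|%N; split; last
  by apply: side_point_on_side => //; move: i0 ij nsep h; case: e f => -[] /=; lia.
rewrite -(side_pointD hm P i 1); apply: side_point_on_side => //.
by move: i0 ij nsep h; rewrite /cell; case: e f => -[] /=; lia.
Qed.

End CellChords.

(** * Geometrical types as numerical data *)

Section Classification.
Context {R : realType} {m : nat} (hm : (3 <= m)%N) (P : regular_polygon R m).
Implicit Types (p q x y z : R * R) (i j k l : int) (e f : bool) (s t : R).
Implicit Types (c : chord R).

Let r0 := radius_gt0 P.

(** The heights tell cells apart: [side_height] vanishes only on its side, and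
[vertex_height] only at its vertex. *)
Lemma side_point_same_cell i e s j f t : 0 < s < 1 -> 0 < t < 1 ->
  side_point P i e s = side_point P j f t -> same_cell m i e j f.
Proof.
move=> s01 t01.
have [n0 nm] : 0 <= ((j - i) %% m%:Z)%Z /\ ((j - i) %% m%:Z)%Z < m%:Z.
  by rewrite modz_ge0 ?ltz_pmod; lia.
have E := divz_eq (j - i) m.
set n := ((j - i) %% m%:Z)%Z in n0 nm E; set k := ((j - i) %/ m%:Z)%Z in E.
have jE : j = i + n + k * m%:Z by lia.
have jE' : j = i + n - m%:Z + (k + 1) * m%:Z by lia.
case: e f => -[] Ep.
- have [n1|n1] := eqVneq n 0; first by split=> //; exists k; lia.
  have := side_height_self P i true s; rewrite Ep jE side_pointD // => /eqP.
  by rewrite gt_eqF //; apply: side_height_point_gt0 => //; lia.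
- have := vertex_height_self hm P j; rewrite -[vtx P j]/(side_point P j false t) -Ep => /eqP.
  rewrite -(side_pointD hm P i k) gt_eqF //.
  have [n1|n1] := eqVneq n 0.
    rewrite -(side_pointD hm P _ (-1)); apply: vertex_height_gt0 => //; rewrite /cell /=; lia.
  by apply: vertex_height_gt0 => //; rewrite /cell /=; lia.
- have := vertex_height_self hm P i; rewrite -[vtx P i]/(side_point P i false s) Ep jE' => /eqP.
  rewrite side_pointD // gt_eqF //.
  by apply: vertex_height_gt0 => //; rewrite /cell /=; lia.
- have [n1|n1] := eqVneq n 0; first by split=> //; exists k; lia.
  have := vertex_height_self hm P i; rewrite -[vtx P i]/(side_point P i false s) Ep jE' => /eqP.
  rewrite side_pointD // gt_eqF //.
  by apply: vertex_height_gt0 => //; rewrite /cell /=; lia.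
Qed.

Lemma same_cell_side_point i e j f s : same_cell m i e j f ->
  side_point P i e s = side_point P j f s.
Proof. by move=> [-> [k ->]]; rewrite side_pointD. Qed.

(** All sides have the same length, so comparing distances along two sides amounts
to comparing ratios. *)
Lemma dist_side_point i s : 0 < s ->
  dist (vtx P i) (side_point P i true s) = s * (2 * radius P * sin_frac (R := R) (m := m) 1).
Proof.
move=> s0; rewrite /dist.
have -> : ((vtx P i).1 - (side_point P i true s).1) ^+ 2
    + ((vtx P i).2 - (side_point P i true s).2) ^+ 2
   = (s * (2 * radius P * sin_frac (R := R) (m := m) 1)) ^+ 2.
  rewrite /side_point !vtxE /= /GRing.scale /=.
  transitivity (s ^+ 2 * radius P ^+ 2 *
    ((cos (angle P i) ^+ 2 + sin (angle P i) ^+ 2)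
     + (cos (angle P (i + 1)) ^+ 2 + sin (angle P (i + 1)) ^+ 2)
     - 2 * cos (angle P i - angle P (i + 1)))).
    by rewrite cosB; ring.
  rewrite !cos2Dsin2.
  have -> : angle P i - angle P (i + 1) = 2 * (pi / m%:R * 1%:~R).
    by rewrite /angle intrD; ring.
  by rewrite cos_double cos2sin2 -/(sin_frac _); ring.
rewrite sqrtr_sqr ger0_norm // mulr_ge0 ?(ltW s0) // mulr_ge0 ?mulr_ge0 ?(ltW r0) //.
by apply: sin_frac_ge0 => //; lia.
Qed.

Lemma side_length_gt0 : 0 < 2 * radius P * sin_frac (R := R) (m := m) 1.
Proof. by rewrite mulr_gt0 ?mulr_gt0 // sin_frac_gt0 //; lia. Qed.

Lemma open_sideP (a : nat) x :
  open_side P a x <-> exists2 s, 0 < s < 1 & x = side_point P a%:Z true s.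
Proof.
rewrite /open_side !(vertexE hm) -addn1 PoszD; split=> -[s s01 xE]; exists s;
  by [move: s01; rewrite /= in_itv|].
Qed.

Lemma vertex_side_point (a : nat) j f t : 0 < t < 1 ->
  (side_point P j f t = vertex P a) <-> same_cell m j f a%:Z false.
Proof.
move=> t01; rewrite (vertexE hm) -[vtx P a%:Z]/(side_point P a%:Z false t); split.
  exact: side_point_same_cell.
exact: same_cell_side_point.
Qed.

Lemma open_side_point (a : nat) j f t : 0 < t < 1 ->
  open_side P a (side_point P j f t) <-> same_cell m j f a%:Z true.
Proof.
move=> t01; rewrite open_sideP; split; first by move=> [s s01]; exact: side_point_same_cell.
by move=> h; exists t => //; exact: same_cell_side_point.
Qed.

Definition chord_at i e s j f t : chord R := (side_point P i e s, side_point P j f t).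

Lemma has_endpoint_vertex i e s j f t (a : nat) : 0 < s < 1 -> 0 < t < 1 ->
  has_endpoint_in (chord_at i e s j f t) [set vertex P a]
  <-> meets_cell m i e j f a%:Z false.
Proof.
move=> s01 t01; rewrite /has_endpoint_in /meets_cell /=.
by split=> -[/vertex_side_point|/vertex_side_point] h; [left|right|left|right]; apply h.
Qed.

Lemma has_endpoint_side i e s j f t (a : nat) : 0 < s < 1 -> 0 < t < 1 ->
  has_endpoint_in (chord_at i e s j f t) (open_side P a)
  <-> meets_cell m i e j f a%:Z true.
Proof.
move=> s01 t01; rewrite /has_endpoint_in /meets_cell /= !open_side_point //.
Qed.

Lemma same_support_meets i e s j f t i' e' s' j' f' t' :
  0 < s < 1 -> 0 < t < 1 -> 0 < s' < 1 -> 0 < t' < 1 ->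
  same_support P (chord_at i e s j f t) (chord_at i' e' s' j' f' t') ->
  forall a b, meets_cell m i e j f a b <-> meets_cell m i' e' j' f' a b.
Proof.
move=> s01 t01 s01' t01' h a b; have [v [k ak]] := int_ord a hm.
have E (x : int) (y : bool) : same_cell m x y a b <-> same_cell m x y (v : nat)%:Z b.
  have ao : same_cell m a b (v : nat)%:Z b.
    by split=> //; exists (- k); rewrite ak mulNr addrK.
  split=> h1; first exact: same_cell_trans h1 ao.
  exact: same_cell_trans h1 (same_cell_sym ao).
rewrite /meets_cell !E; move: (h v) => -[hv hs].
case: b {E} => //.
  by move: hs; rewrite !has_endpoint_side.
by move: hv; rewrite !has_endpoint_vertex.
Qed.

Lemma meets_same_support i e s j f t s' t' :
  0 < s < 1 -> 0 < t < 1 -> 0 < s' < 1 -> 0 < t' < 1 ->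
  same_support P (chord_at i e s j f t) (chord_at i e s' j f t').
Proof.
by move=> s01 t01 s01' t01' a; rewrite !has_endpoint_vertex // !has_endpoint_side.
Qed.

(** The clockwise distance of the cells, whether both are sides, on which side of
the chord the centre lies (1 if the clockwise arc from the first endpoint to the
second is the shorter one), and for two sides the comparison of the ratios. *)
Definition type_at i e s j f t : cut_type :=
  (cell j f - cell i e, e && f,
   sgz (orient (side_point P i e s) (side_point P j f t) (center P)),
   if e && f then sgz (t - s) else 0).

Lemma type_at_swap i e s j f t :
  type_at j f t (i + 1 * m%:Z) e s = swap_type m (type_at i e s j f t).
Proof.
rewrite /type_at /swap_type /= side_pointD // andbC orient_swap sgzN /cell.
congr (_, _, _, _); first lia.
by case: ifP => _; rewrite ?oppr0 // -sgzN opprB.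
Qed.

Lemma type_at_turn k i e s j f t :
  type_at (i + k) e s (j + k) f t = type_at i e s j f t.
Proof.
rewrite /type_at /cell; congr (_, _, _, _); [lia|congr sgz].
rewrite -!turn_side_point /turn /rotation /orient /=; set c := - _.
have h := cos2Dsin2 c.
transitivity ((cos c ^+ 2 + sin c ^+ 2) *
 orient (side_point P i e s) (side_point P j f t) (center P)).
  by rewrite /orient; ring.
by rewrite h mul1r.
Qed.

(** The flip reverses the chord and the plane, and the two changes of sign of the
orientation cancel. *)
Lemma type_at_flip k i e s j f t :
  type_at (k - j - f%:Z) f (1 - t) (k - i - e%:Z) e (1 - s) = type_at i e s j f t.
Proof.
rewrite /type_at /cell andbC; congr (_, _, _, _); [lia| |].
  congr sgz; rewrite -!(flip_side_point hm) /flip /reflection /orient /=.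
  set c : R := 2 * (phase P - _).
  have h := cos2Dsin2 c.
  transitivity ((cos c ^+ 2 + sin c ^+ 2) *
    orient (side_point P i e s) (side_point P j f t) (center P)).
    by rewrite /orient; ring.
  by rewrite h mul1r.
by case: ifP => // _; congr sgz; ring.
Qed.

(** The vertices of a piece depend only on the two cells; this is what makes pieces
of different chords comparable. *)
Lemma half_vertexE i e s j f t l : separated m i e j f ->
  0 < s < 1 -> 0 < t < 1 ->
  half_region P (side_point P i e s) (side_point P j f t) (vtx P l) <->
  exists k, cell i e < 2 * (l + k * m%:Z) < cell j f.
Proof.
move=> sep s01 t01; split=> [hl|[k lk]]; last first.
  by rewrite -(vtxD hm P l k); exact: separated_vertex.
have [n [k [n0 nm E]]] : exists n k, [/\ 0 <= n, n < m%:Z & l - i - e%:Z = k * m%:Z + n].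
  exists ((l - i - e%:Z) %% m%:Z)%Z, ((l - i - e%:Z) %/ m%:Z)%Z.
  by split; [rewrite modz_ge0|rewrite ltz_pmod|exact: divz_eq]; lia.
exists (- k); have -> : l + - k * m%:Z = i + e%:Z + n by lia.
have lE : vtx P l = vtx P (i + e%:Z + n).
  by rewrite -(vtxD hm P (i + e%:Z + n) k); congr vtx; lia.
rewrite lE in hl; apply/andP; split.
  rewrite /cell; case: e {sep E k lE} hl => hl; first by lia.
  have [n1|n1] := eqVneq n 0; last by lia.
  have il : i + false%:Z + n = i by lia.
  by case: hl => _; rewrite il /= /orient !subrr !mulr0 subrr ltxx.
rewrite ltNge; apply/negP; rewrite le_eqVlt => /orP[/eqP h|h].
  have fE : ~~ f /\ j = i + e%:Z + n by move: h; rewrite /cell; case: f {sep hl lE} => /=; lia.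
  case: fE hl => /negbTE -> -> [_ /=].
  by rewrite orient_rot orient_swap orient_rot /orient /= !(subrr, mulr0, oppr0) ltxx.
have := separated_vertex_swap hm P s01 t01 sep (l := i + e%:Z + n).
rewrite h /= => /(_ _)/(half_disjoint hl); apply.
by rewrite /cell; case: e {sep E lE hl h}; lia.
Qed.

Lemma interior_half p q : orient p q (center P) < 0 ->
  interior (half_region P p q) (center P).
Proof.
move=> o0; apply: filterI; first exact: region_nbhs_center.
have /(_ (center P)) := @continuous_orient R p q.
move=> /(_ [set y | y < 0]); apply; exact: lt_nbhsl.
Qed.

Lemma half_center p q : half_region P p q (center P) -> orient p q (center P) < 0.
Proof. by case. Qed.

(** Each piece has a vertex, and no vertex lies in both; so pieces with the same
vertices lie on corresponding sides of their chords. *)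
Lemma same_center_type i e s j f t s' t' : separated m i e j f ->
  0 < s < 1 -> 0 < t < 1 -> 0 < s' < 1 -> 0 < t' < 1 ->
  same_center_position P (chord_at i e s j f t) (chord_at i e s' j f t') <->
  sgz (orient (side_point P i e s) (side_point P j f t) (center P))
  = sgz (orient (side_point P i e s') (side_point P j f t') (center P)).
Proof.
move=> sep s01 t01 s01' t01'.
have [l lP] : exists l : 'I_m,
   half_region P (side_point P i e s) (side_point P j f t) (vertex P l)
   /\ half_region P (side_point P i e s') (side_point P j f t') (vertex P l).
  have [l lE] := vtx_ord hm P (i + 1); exists l; rewrite -lE.
  by split; apply: separated_vertex => //; exact: separated_between sep.
have vv (b : 'I_m) : (half_region P (side_point P i e s) (side_point P j f t) (vertex P b)
   <-> half_region P (side_point P i e s') (side_point P j f t') (vertex P b)) /\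
   (half_region P (side_point P j f t) (side_point P i e s) (vertex P b)
   <-> half_region P (side_point P j f t') (side_point P i e s') (vertex P b)).
  rewrite !(vertexE hm); split; first by rewrite !half_vertexE.
  move: (sep); rewrite separated_swap // => sep'.
  by rewrite -!(side_pointD hm P i 1) !half_vertexE.
rewrite /same_center_position !separated_pieces //.
set p := side_point P i e s in lP vv *; set q := side_point P j f t in lP vv *.
set p' := side_point P i e s' in lP vv *; set q' := side_point P j f t' in lP vv *.
split.
  case=> [[/orient_on_segment -> /orient_on_segment -> //]|].
  move=> [A [A' [hA hA' cA cA' AA']]].
  have {}cA := interior_subset cA; have {}cA' := interior_subset cA'.
  case: lP => l1 l2.
  case: hA => /= hA; case: hA' => /= hA'; subst A A'.
  - by rewrite !ltr0_sgz //; apply: half_center.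
  - by case: (half_disjoint l2); apply/AA'.
  - by case: (half_disjoint l1); apply/AA'.
  - by move/half_swapE: cA => [_ /gtr0_sgz ->]; move/half_swapE: cA' => [_ /gtr0_sgz ->].
have [lt0|gt0|eq0] := ltgtP (orient p q (center P)) 0.
- rewrite ltr0_sgz // => /esym/eqP; rewrite sgz_cp0 => o2; right.
  exists (half_region P p q), (half_region P p' q'); split; [by left|by left| | |].
  + exact: interior_half.
  + exact: interior_half.
  + by move=> b; have [] := vv b.
- rewrite gtr0_sgz // => /esym/eqP; rewrite sgz_cp0 => o2; right.
  exists (half_region P q p), (half_region P q' p'); split; [by right|by right| | |].
  + by apply: interior_half; rewrite orient_swap oppr_lt0.
  + by apply: interior_half; rewrite orient_swap oppr_lt0.
  + by move=> b; have [] := vv b.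
- rewrite eq0 sgz0 => /esym/eqP; rewrite sgz_eq0 => /eqP o2; left.
  split; apply: (separated_full_chord hm) => //; exact: region_center.
Qed.

End Classification.

Section ClassificationOfCuts.
Context {R : realType} {m : nat} (hm : (3 <= m)%N) (P : regular_polygon R m).
Implicit Types (p q x y z : R * R) (i j k l : int) (e f : bool) (s t : R).
Implicit Types (c : chord R).

Lemma sgz_sub_eq (s t s' t' : R) : sgz (t - s) = sgz (t' - s') <->
  [/\ s < t <-> s' < t', s = t <-> s' = t' & t < s <-> t' < s'].
Proof.
have E (u v : R) : [/\ sgz (v - u) = 1 <-> u < v, sgz (v - u) = 0 <-> u = v
    & sgz (v - u) = -1 <-> v < u].
  split; split.
  - by move=> /eqP; rewrite sgz_cp0 subr_gt0.
  - by move=> h; apply/eqP; rewrite sgz_cp0 subr_gt0.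
  - by move=> /eqP; rewrite sgz_cp0 subr_eq0 => /eqP.
  - by move=> h; apply/eqP; rewrite sgz_cp0 subr_eq0 h.
  - by move=> /eqP; rewrite sgz_cp0 subr_lt0.
  - by move=> h; apply/eqP; rewrite sgz_cp0 subr_lt0.
have [a1 a2 a3] := E s t; have [b1 b2 b3] := E s' t'; split.
  by move=> h; split; [rewrite -a1 -b1 h|rewrite -a2 -b2 h|rewrite -a3 -b3 h].
case=> c1 c2 c3; have [h|h|h] := ltgtP s t.
- by rewrite (a1.2 h) (b1.2 (c1.1 h)).
- by rewrite (a3.2 h) (b3.2 (c3.1 h)).
- by rewrite (a2.2 h) (b2.2 (c2.1 h)).
Qed.

Lemma dist_vertex_side_point (a : nat) i e s : 0 < s -> same_cell m i e a%:Z true ->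
  dist (vertex P a) (side_point P i e s) = s * (2 * radius P * sin_frac (R := R) (m := m) 1).
Proof.
by move=> s0 h; rewrite (same_cell_side_point hm P s h) (vertexE hm) dist_side_point.
Qed.

Lemma endpoint_side i e s j f t (a : nat) x : 0 < s < 1 -> 0 < t < 1 ->
  has_endpoint_in (chord_at P i e s j f t) [set x] -> open_side P a x ->
  (x = side_point P i e s /\ same_cell m i e a%:Z true) \/
  (x = side_point P j f t /\ same_cell m j f a%:Z true).
Proof.
move=> s01 t01 [] /= <- /(open_side_point hm) h; [left|right]; split=> //; exact: h.
Qed.

Lemma dist_comparison (a b : nat) i e j f s t s' t' :
  0 < s -> 0 < t -> 0 < s' -> 0 < t' ->
  same_cell m i e a%:Z true -> same_cell m j f b%:Z true ->
  let d1 := dist (vertex P a) (side_point P i e s) in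
  let d2 := dist (vertex P b) (side_point P j f t) in
  let d1' := dist (vertex P a) (side_point P i e s') in
  let d2' := dist (vertex P b) (side_point P j f t') in
  [/\ d1 < d2 <-> d1' < d2', d1 = d2 <-> d1' = d2' & d2 < d1 <-> d2' < d1']
  <-> sgz (t - s) = sgz (t' - s').
Proof.
move=> s0 t0 s0' t0' ia jb; rewrite /= !dist_vertex_side_point // -sgz_sub_eq.
move: (2 * _ * _) (side_length_gt0 hm P) => L L0.
by rewrite -!mulrBl !sgzM (gtr0_sgz L0) !mulr1.
Qed.

Lemma same_comparison_type i e s j f t s' t' : separated m i e j f ->
  0 < s < 1 -> 0 < t < 1 -> 0 < s' < 1 -> 0 < t' < 1 ->
  same_comparison P (chord_at P i e s j f t) (chord_at P i e s' j f t') <->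
  (e && f -> sgz (t - s) = sgz (t' - s')).
Proof.
move=> sep s01 t01 s01' t01'.
have [s0 _] := andP s01; have [t0 _] := andP t01.
have [s0' _] := andP s01'; have [t0' _] := andP t01'.
have nb := separated_not_both sep.
split=> [h /andP[eT fT]|h a b x y x' y' ab x1 x2 y1 y2 x1' x2' y1' y2'].
  rewrite eT fT in sep h nb *.
  have [a [k ak]] := int_ord i hm; have [b [k' bk]] := int_ord j hm.
  have ia : same_cell m i true (a : nat)%:Z true.
    by split=> //; exists (- k); rewrite ak mulNr addrK.
  have jb : same_cell m j true (b : nat)%:Z true.
    by split=> //; exists (- k'); rewrite bk mulNr addrK.
  have oi u : 0 < u < 1 -> open_side P a (side_point P i true u).
    by move=> u01; apply/(open_side_point hm).
  have oj u : 0 < u < 1 -> open_side P b (side_point P j true u).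
    by move=> u01; apply/(open_side_point hm).
  have [ab|ba|ab] := ltngtP a b; last by case: (nb _ ia); rewrite ab.
    have := h a b (side_point P i true s) (side_point P j true t)
      (side_point P i true s') (side_point P j true t') ab.
    move=> /(_ (or_introl erefl) (oi _ s01) (or_intror erefl) (oj _ t01)).
    move=> /(_ (or_introl erefl) (oi _ s01') (or_intror erefl) (oj _ t01')).
    by move=> /(dist_comparison s0 t0 s0' t0' ia jb).
  have := h b a (side_point P j true t) (side_point P i true s)
    (side_point P j true t') (side_point P i true s') ba.
  move=> /(_ (or_intror erefl) (oj _ t01) (or_introl erefl) (oi _ s01)).
  move=> /(_ (or_intror erefl) (oj _ t01') (or_introl erefl) (oi _ s01')).
  move=> /(dist_comparison t0 s0 t0' s0' jb ia) E.
  by rewrite -[LHS]opprK -sgzN opprB E -sgzN opprB.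
have nab e1 i1 : same_cell m i1 e1 (a : nat)%:Z true ->
    same_cell m i1 e1 (b : nat)%:Z true -> False.
  by move=> h1 h2; move: ab; rewrite (same_cell_ord h1 h2) ltnn.
have [[xE ia]|[xE ja]] := endpoint_side s01 t01 x1 x2.
  have [[yE ib]|[yE jb]] := endpoint_side s01 t01 y1 y2; first by case: (nab _ _ ia ib).
  have [[xE' _]|[_ ja]] := endpoint_side s01' t01' x1' x2'; last by case: (nb _ ia ja).
  have [[_ ib]|[yE' _]] := endpoint_side s01' t01' y1' y2'; first by case: (nab _ _ ia ib).
  rewrite xE yE xE' yE'; apply/(dist_comparison s0 t0 s0' t0' ia jb); apply: h.
  by case: ia jb => -> _ [-> _].
have [[yE ib]|[yE jb]] := endpoint_side s01 t01 y1 y2; last by case: (nab _ _ ja jb).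
have [[_ ia]|[xE' _]] := endpoint_side s01' t01' x1' x2'; first by case: (nb _ ia ja).
have [[yE' _]|[_ jb]] := endpoint_side s01' t01' y1' y2'; last by case: (nab _ _ ja jb).
rewrite xE yE xE' yE'; apply/(dist_comparison t0 s0 t0' s0' ja ib).
rewrite -[LHS]opprK -sgzN opprB h -?sgzN ?opprB //.
by case: ib ja => -> _ [-> _].
Qed.

Definition swap_chord c : chord R := (c.2, c.1).

Lemma has_endpoint_swap c A : has_endpoint_in (swap_chord c) A = has_endpoint_in c A.
Proof. by apply/propext; rewrite /has_endpoint_in /=; split=> -[]; [right|left|right|left]. Qed.

Lemma chord_set_swap c : chord_set (swap_chord c) = chord_set c.
Proof. by rewrite /chord_set /= segment_swap. Qed.

Lemma pieces_swap c : pieces P (swap_chord c) = pieces P c.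
Proof. by rewrite /pieces chord_set_swap. Qed.

Lemma same_support_swap c c' :
  (same_support P (swap_chord c) c' <-> same_support P c c') /\
  (same_support P c (swap_chord c') <-> same_support P c c').
Proof.
by rewrite /same_support; split; split=> h a; move: (h a); rewrite !has_endpoint_swap.
Qed.

Lemma same_center_swap c c' :
  (same_center_position P (swap_chord c) c' <-> same_center_position P c c') /\
  (same_center_position P c (swap_chord c') <-> same_center_position P c c').
Proof. by rewrite /same_center_position !chord_set_swap !pieces_swap. Qed.

Lemma same_comparison_swap c c' :
  (same_comparison P (swap_chord c) c' <-> same_comparison P c c') /\
  (same_comparison P c (swap_chord c') <-> same_comparison P c c').
Proof.
rewrite /same_comparison; split; split=> h a b x y x' y' ab;
  by move: (h a b x y x' y' ab); rewrite !has_endpoint_swap.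
Qed.

(** The three conditions of [same_geotype] without the symmetry. *)
Definition similar c c' := [/\ same_support P c c', same_center_position P c c'
  & same_comparison P c c'].

Lemma similar_swapl c c' : similar (swap_chord c) c' <-> similar c c'.
Proof.
have [a _] := same_support_swap c c'; have [b _] := same_center_swap c c'.
have [d _] := same_comparison_swap c c'.
by rewrite /similar; split=> -[h1 h2 h3]; split;
  [apply/a|apply/b|apply/d|apply/a|apply/b|apply/d].
Qed.

Lemma similar_swapr c c' : similar c (swap_chord c') <-> similar c c'.
Proof.
have [_ a] := same_support_swap c c'; have [_ b] := same_center_swap c c'.
have [_ d] := same_comparison_swap c c'.
by rewrite /similar; split=> -[h1 h2 h3]; split;
  [apply/a|apply/b|apply/d|apply/a|apply/b|apply/d].
Qed.

Lemma similar_same_cells i e s j f t s' t' : separated m i e j f ->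
  0 < s < 1 -> 0 < t < 1 -> 0 < s' < 1 -> 0 < t' < 1 ->
  similar (chord_at P i e s j f t) (chord_at P i e s' j f t') <->
  type_at P i e s' j f t' = type_at P i e s j f t.
Proof.
move=> sep s01 t01 s01' t01'; rewrite /similar /type_at; split.
  move=> [_ /(same_center_type hm P sep s01 t01 s01' t01') ->].
  move=> /(same_comparison_type sep s01 t01 s01' t01').
  by case: (e && f) => // ->.
case=> cE rE; split.
- exact: meets_same_support.
- by apply/(same_center_type hm P sep s01 t01 s01' t01').
- apply/(same_comparison_type sep s01 t01 s01' t01') => ef; move: rE; rewrite ef.
  by move->.
Qed.

Lemma chord_atD i e s j f t k :
  chord_at P (i + k * m%:Z) e s (j + k * m%:Z) f t = chord_at P i e s j f t.
Proof. by rewrite /chord_at !side_pointD. Qed.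

Lemma chord_at_swap i e s j f t :
  chord_at P j f t (i + 1 * m%:Z) e s = swap_chord (chord_at P i e s j f t).
Proof. by rewrite /chord_at side_pointD. Qed.

(** Equal supports leave two ways of matching the endpoints; the second one reads
one of the chords backwards. *)
Lemma similar_type i e s j f t i' e' s' j' f' t' :
  separated m i e j f -> separated m i' e' j' f' ->
  0 < s < 1 -> 0 < t < 1 -> 0 < s' < 1 -> 0 < t' < 1 ->
  similar (chord_at P i e s j f t) (chord_at P i' e' s' j' f' t') ->
  type_at P i' e' s' j' f' t' = type_at P i e s j f t \/
  type_at P i' e' s' j' f' t' = swap_type m (type_at P i e s j f t).
Proof.
move=> sep sep' s01 t01 s01' t01' sim; have [sup _ _] := sim.
have [] := meets_match sep sep' (same_support_meets hm s01 t01 s01' t01' sup).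
  move=> [ii jj]; have [eE _] := ii; have [fE _] := jj; left.
  move: ii jj sep' sim; rewrite -eE -fE => ii jj sep' sim.
  have [k [iE jE]] := separated_shift sep sep' ii jj.
  move: sim; rewrite iE jE chord_atD => /(similar_same_cells sep s01 t01 s01' t01') <-.
  by rewrite (type_at_turn hm).
move=> [ii jj]; have [eE _] := ii; have [fE _] := jj; right.
move: ii jj sep' sim; rewrite -eE -fE => ii jj sep' sim.
have [k [iE jE]] := separated_shift_swap sep sep' ii jj.
have jE' : j' = (i + 1 * m%:Z) + k * m%:Z by rewrite jE mulrDl addrA addrAC.
move: sim; rewrite iE jE' chord_atD chord_at_swap // => /similar_swapr.
move=> /(similar_same_cells sep s01 t01 t01' s01') <-.
by rewrite (type_at_turn hm) type_at_swap.
Qed.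

Lemma chord_image_turn i e s j f t k :
  chord_image (turn P k) (chord_at P i e s j f t)
  = chord_at P (i + k) e s (j + k) f t.
Proof. by rewrite /chord_image /= !turn_side_point. Qed.

Lemma chord_image_flip i e s j f t k :
  chord_image (flip P k) (chord_at P i e s j f t)
  = swap_chord (chord_at P (k - j - f%:Z) f (1 - t) (k - i - e%:Z) e (1 - s)).
Proof. by rewrite /chord_image /= !flip_side_point. Qed.

Lemma geotype_type i e s j f t i' e' s' j' f' t' :
  separated m i e j f -> separated m i' e' j' f' ->
  0 < s < 1 -> 0 < t < 1 -> 0 < s' < 1 -> 0 < t' < 1 ->
  same_geotype P (chord_at P i e s j f t) (chord_at P i' e' s' j' f' t') ->
  type_at P i' e' s' j' f' t' = type_at P i e s j f t \/
  type_at P i' e' s' j' f' t' = swap_type m (type_at P i e s j f t).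
Proof.
move=> sep sep' s01 t01 s01' t01' [g /(symmetryP hm)[k [->|->]]].
  rewrite chord_image_turn => sim.
  rewrite -(type_at_turn hm P k i); apply: similar_type sim => //.
  by rewrite separated_turn.
rewrite chord_image_flip => /similar_swapl sim.
rewrite -(type_at_flip hm P k i); apply: similar_type sim => //.
- by rewrite separated_flip.
- lra.
- lra.
Qed.

(** If the flags of the endpoints agree, a turn superposes the two supports. If
they do not, the chords join a vertex and a side in opposite orders, and a flip
does. *)
Lemma type_geotype i e s j f t i' e' s' j' f' t' :
  separated m i e j f -> separated m i' e' j' f' ->
  0 < s < 1 -> 0 < t < 1 -> 0 < s' < 1 -> 0 < t' < 1 ->
  type_at P i' e' s' j' f' t' = type_at P i e s j f t ->
  same_geotype P (chord_at P i e s j f t) (chord_at P i' e' s' j' f' t').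
Proof.
move=> sep sep' s01 t01 s01' t01' tE.
have [gE bE] : cell j' f' - cell i' e' = cell j f - cell i e /\ e' && f' = e && f.
  by case: tE.
have [eE|eE] := eqVneq e' e.
  have fE : f' = f.
    by clear -gE bE eE; move: gE bE; rewrite /cell eE; case: e f f' {eE} => -[] [] //=; lia.
  have [k [iE jE]] : exists k, i' = i + k /\ j' = j + k.
    exists (i' - i); clear -gE eE fE; rewrite /cell eE fE in gE; lia.
  exists (turn P k); first exact: turn_symmetry.
  rewrite chord_image_turn; move: sep' tE; rewrite eE fE iE jE => sep' tE.
  apply: (similar_same_cells sep' s01 t01 s01' t01').2.
  by rewrite tE (type_at_turn hm).
have [efE feE] : e' = f /\ f' = e.
  clear -gE bE eE; move: gE bE eE; rewrite /cell.
  by case: e f e' f' => -[] [] [] //=; lia.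
exists (flip P (i' + j + f%:Z)); first exact: flip_symmetry.
rewrite chord_image_flip; apply: (similar_swapl _ _).2.
have iE : i' + j + f%:Z - j - f%:Z = i' by ring.
have jE : i' + j + f%:Z - i - e%:Z = j'.
  by clear -gE efE feE; move: gE; rewrite /cell efE feE; lia.
move: sep' tE; rewrite -(type_at_flip hm P (i' + j + f%:Z) i) iE jE efE feE => sep' tE.
have t01c : 0 < 1 - t < 1 by lra.
have s01c : 0 < 1 - s < 1 by lra.
exact: (similar_same_cells sep' t01c s01c s01' t01').2.
Qed.

(** A cut has its data in both readings; the relation leaves the reading open. *)
Definition has_type c (u : cut_type) : Prop := exists i e s j f t,
  [/\ 0 < s < 1 /\ 0 < t < 1, separated m i e j f,
      c = chord_at P i e s j f t \/ c = swap_chord (chord_at P i e s j f t)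
    & type_at P i e s j f t = u].

Lemma has_type_swap c u : has_type c u -> has_type c (swap_type m u).
Proof.
move=> [i [e [s [j [f [t [[s01 t01] sep cE <-]]]]]]].
exists j, f, t, (i + 1 * m%:Z), e, s; split=> //.
- by rewrite -separated_swap.
- by rewrite chord_at_swap; case: cE => ->; [right|left].
- exact: type_at_swap.
Qed.

Lemma has_type_is_cut c u : has_type c u -> is_cut P c.
Proof.
move=> [i [e [s [j [f [t [[s01 t01] sep [->|->] _]]]]]]].
  exact: separated_is_cut.
exact/is_cut_swap/separated_is_cut.
Qed.

Lemma is_cut_has_type c : is_cut P c -> exists u, has_type c u.
Proof.
case: c => p q cut; have [bp bq _ _] := cut.
have [i [e [s [i0 s01 pE]]]] := boundary_cell hm bp.
have [j [f [t [j0 t01 qE]]]] := boundary_cell hm bq.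
rewrite /= in pE qE; subst p q.
have [h|h] := boolP (cell i e <= cell j f).
  exists (type_at P i e s j f t), i, e, s, j, f, t; split=> //; last by left.
  apply: contraT => nsep; exfalso.
  have [||k [k1 k2]] := not_separated_common_side hm P s01 t01 _ _ nsep.
  - lia.
  - lia.
  - exact: (common_side_not_cut hm k1 k2 cut).
exists (type_at P j f t i e s), j, f, t, i, e, s; split=> //; last by right.
apply: contraT => nsep; exfalso.
have [||k [k1 k2]] := not_separated_common_side hm P t01 s01 _ _ nsep.
- lia.
- lia.
- exact: (common_side_not_cut hm k2 k1 cut).
Qed.

Lemma same_geotype_swapl c c' : same_geotype P (swap_chord c) c' <-> same_geotype P c c'.
Proof.
by split=> -[g gs h]; exists g => //;
  move: h; [move=> /similar_swapl|move=> h; apply/similar_swapl].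
Qed.

Lemma same_geotype_swapr c c' : same_geotype P c (swap_chord c') <-> same_geotype P c c'.
Proof.
by split=> -[g gs h]; exists g => //;
  move: h; [move=> /similar_swapr|move=> h; apply/similar_swapr].
Qed.

Lemma same_geotypeP c c' u u' : has_type c u -> has_type c' u' ->
  same_geotype P c c' <-> u' = u \/ u' = swap_type m u.
Proof.
move=> [i [e [s [j [f [t [[s01 t01] sep cE uE]]]]]]].
move=> [i' [e' [s' [j' [f' [t' [[s01' t01'] sep' cE' uE']]]]]]].
have -> : same_geotype P c c' <->
    same_geotype P (chord_at P i e s j f t) (chord_at P i' e' s' j' f' t').
  by case: cE => ->; case: cE' => ->; rewrite ?same_geotype_swapl ?same_geotype_swapr.
rewrite -uE -uE'; split; first exact: geotype_type.
case; first exact: type_geotype.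
rewrite -type_at_swap // => tE.
apply/same_geotype_swapl; rewrite -chord_at_swap //; apply: type_geotype tE => //.
by rewrite -separated_swap.
Qed.

End ClassificationOfCuts.

(** * The list of possible types *)

Section Types.
Context (m : nat) (hm : (3 <= m)%N).

(** For d < m the shorter arc is known and the third entry is 1; for d = m the
chord is a diameter. *)
Definition VV_types : seq cut_type :=
  [seq ((2 * k)%N%:Z, false, (2 * k < m)%N%:Z, 0%Z) | k <- iota 2 (m./2).-1].

Definition VS_types : seq cut_type :=
  [seq ((2 * k).+1%:Z, false, 1%Z, 0%Z) | k <- iota 1 (m.-1)./2] ++
  if odd m then [:: (m%:Z, false, 0%Z, 0%Z)] else [::].

(** The last two entries are the cases where the arc may reach half a turn. For
odd m the centre can lie on the chord or beyond it only if s < t; for even m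
the sides are opposite and the centre lies on the chord only if s = t, while
s < t and s > t are two readings of one type. *)
Definition SS_types : seq cut_type :=
  [seq ((2 * k)%N%:Z, true, 1%Z, (-1)%Z) | k <- iota 1 (m.-1)./2] ++
  [seq ((2 * k)%N%:Z, true, 1%Z, 0%Z) | k <- iota 1 (m.-1)./2] ++
  [seq ((2 * k)%N%:Z, true, 1%Z, 1%Z) | k <- iota 1 (m.-1)./2] ++
  if odd m then [:: (m.-1%:Z, true, 0%Z, 1%Z); (m.-1%:Z, true, (-1)%Z, 1%Z)]
  else [:: (m%:Z, true, 0%Z, 0%Z); (m%:Z, true, 1%Z, (-1)%Z)].

(** Of the two readings of a chord at least one is normal, and both are only if
d = m and the centre lies on the chord. *)
Definition normal (u : cut_type) : bool :=
  let: (d, b, sg, rh) := u in (d < m%:Z) || (d == m%:Z) && (0 <= sg).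

Lemma VV_typesP u : u \in VV_types <->
  exists2 k : int, 4 <= 2 * k <= m%:Z &
    u = (2 * k, false, if 2 * k < m%:Z then 1%Z else 0%Z, 0%Z).
Proof.
split=> [/mapP[k + ->]|[k hk ->]].
  rewrite mem_iota => hk; exists k%:Z; first by lia.
  by congr (_, _, _, _); case: ltnP => h /=; case: ltP; lia.
apply/mapP; exists `|k|%N; first by rewrite mem_iota; lia.
by congr (_, _, _, _); first (by lia); case: ltnP => h /=; case: ltP; lia.
Qed.

Lemma VS_typesP u : u \in VS_types <->
  exists2 k : int, 3 <= 2 * k + 1 <= m%:Z &
    u = (2 * k + 1, false, 1%Z, 0%Z) \/
    2 * k + 1 = m%:Z /\ u = (2 * k + 1, false, 0%Z, 0%Z).
Proof.
rewrite mem_cat; split=> [/orP[/mapP[k + ->]|]|[k hk [->|[km ->]]]].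
- rewrite mem_iota => hk; exists k%:Z; first by lia.
  by left; congr (_, _, _, _); lia.
- have [mo|//] := boolP (odd m); rewrite inE => /eqP ->.
  exists (m./2)%:Z; first by lia.
  by right; split; [lia|congr (_, _, _, _); lia].
- apply/orP; left; apply/mapP; exists `|k|%N; first by rewrite mem_iota; lia.
  by congr (_, _, _, _); lia.
- have -> : odd m by lia.
  by apply/orP; right; rewrite inE km.
Qed.

Lemma SS_typesP u : u \in SS_types <->
  exists2 k : int, 2 <= 2 * k <= m%:Z &
  [\/ exists2 rh, rh \in [:: (-1)%Z; 0%Z; 1%Z] & 2 * k < m%:Z /\ u = (2 * k, true, 1%Z, rh),
      2 * k = m%:Z - 1 /\ (u = (2 * k, true, 0%Z, 1%Z) \/ u = (2 * k, true, (-1)%Z, 1%Z))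
    | 2 * k = m%:Z /\ (u = (2 * k, true, 0%Z, 0%Z) \/ u = (2 * k, true, 1%Z, (-1)%Z))].
Proof.
rewrite !mem_cat; split.
  have S r : r \in [:: (-1)%Z; 0%Z; 1%Z] ->
      u \in [seq ((2 * k)%N%:Z, true, 1%Z, r) | k <- iota 1 (m.-1)./2] ->
      exists2 k : int, 2 <= 2 * k <= m%:Z & exists2 rh, rh \in [:: (-1)%Z; 0%Z; 1%Z]
        & 2 * k < m%:Z /\ u = (2 * k, true, 1%Z, rh).
    move=> rE /mapP[k + ->]; rewrite mem_iota => hk; exists k%:Z; first by lia.
    by exists r => //; split; [lia|congr (_, _, _, _); lia].
  case/or4P => [/S|/S|/S|].
  - by move=> /(_ isT)[k hk h]; exists k => //; constructor 1.
  - by move=> /(_ isT)[k hk h]; exists k => //; constructor 1.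
  - by move=> /(_ isT)[k hk h]; exists k => //; constructor 1.
  have [mo|mo] := boolP (odd m); rewrite !inE => h; exists (m./2)%:Z; try lia.
    constructor 2; split; first by lia.
    have -> : 2 * (m./2)%:Z = m.-1%:Z by lia.
    by case/orP: h => /eqP; [left|right].
  constructor 3; split; first by lia.
  have -> : 2 * (m./2)%:Z = m%:Z by lia.
  by case/orP: h => /eqP; [left|right].
move=> [k hk [[rh rhE [km ->]]|[km h]|[km h]]].
- have E r : (2 * k, true, 1%Z, r) \in
      [seq ((2 * k)%N%:Z, true, 1%Z, r) | k <- iota 1 (m.-1)./2].
    apply/mapP; exists `|k|%N; first by rewrite mem_iota; lia.
    by congr (_, _, _, _); lia.
  by move: rhE; rewrite !inE => /or3P[] /eqP ->; rewrite !E ?orbT.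
- have -> : odd m by lia.
  have <- : 2 * k = m.-1%:Z by lia.
  by case: h => ->; rewrite !inE eqxx ?orbT.
- have -> : odd m = false by lia.
  by rewrite -km; case: h => ->; rewrite !inE eqxx ?orbT.
Qed.

Lemma size_SS_types : size SS_types = (3 * (m.-1)./2 + 2)%N.
Proof. by rewrite !size_cat !size_map !size_iota; case: odd => /=; lia. Qed.

Lemma size_VV_types : size VV_types = (m./2).-1.
Proof. by rewrite size_map size_iota. Qed.

Lemma size_VS_types : size VS_types = ((m.-1)./2 + odd m)%N.
Proof. by rewrite size_cat size_map size_iota; case: odd. Qed.

Lemma uniq_VV : uniq VV_types.
Proof. by rewrite map_inj_uniq ?iota_uniq // => k k' [] h; lia. Qed.

Lemma uniq_VS : uniq VS_types.
Proof.
rewrite cat_uniq map_inj_uniq ?iota_uniq /=; last by move=> k k' [] h; lia.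
apply/andP; split; last by case: odd.
apply/hasPn => u; case: odd => //; rewrite inE => /eqP ->.
by apply/negP => /mapP[k _ []].
Qed.

Lemma uniq_SS : uniq SS_types.
Proof.
have U r : uniq [seq ((2 * k)%N%:Z, true, 1%Z, r) | k <- iota 1 (m.-1)./2].
  by rewrite map_inj_uniq ?iota_uniq // => k k' [] h; lia.
have D r (X : seq cut_type) :
    (forall u, u \in X -> ((u.1.2, u.2) != (1%Z, r)) || (u.1.1.1 == m%:Z)) ->
    ~~ has (mem [seq ((2 * k)%N%:Z, true, 1%Z, r) | k <- iota 1 (m.-1)./2]) X.
  move=> h; apply/hasPn => u /h; apply: contraL => /mapP[k + ->] /=.
  by rewrite mem_iota eqxx /= => hk; apply/eqP; lia.
rewrite !cat_uniq !U /=.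
rewrite !D.
- by case: odd; rewrite /= inE andbT; apply/eqP => -[].
- by move=> u; case: odd; rewrite !inE => /orP[] /eqP ->; rewrite ?eqxx ?orbT.
- move=> u; rewrite mem_cat => /orP[/mapP[k _ ->] //|].
  by case: odd; rewrite !inE => /orP[] /eqP ->; rewrite ?eqxx ?orbT.
- move=> u; rewrite !mem_cat => /or3P[/mapP[k _ ->] //|/mapP[k _ ->] //|].
  by case: odd; rewrite !inE => /orP[] /eqP ->; rewrite ?eqxx ?orbT.
Qed.

Definition all_types : seq cut_type := VV_types ++ VS_types ++ SS_types.

Lemma size_all_types :
  size all_types = ((m./2).-1 + ((m.-1)./2 + odd m) + (3 * (m.-1)./2 + 2))%N.
Proof.
rewrite size_cat [size (_ ++ SS_types)]size_cat addnA.
by rewrite size_VV_types size_VS_types size_SS_types.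
Qed.

Lemma mem_all_types u : (u \in all_types) =
  [|| u \in VV_types, u \in VS_types | u \in SS_types].
Proof. by rewrite mem_cat [X in _ || X]mem_cat. Qed.

Lemma uniq_all_types : uniq all_types.
Proof.
rewrite cat_uniq uniq_VV /=; apply/andP; split; last first.
  rewrite cat_uniq uniq_VS uniq_SS andbT /=.
  apply/hasPn => u /SS_typesP hS; apply/negP => /VS_typesP hV.
  have [k _ [uE|[_ uE]]] := hV; move: hS; rewrite uE;
  by move=> [k' _ [[rh _ [_ []]]|[_ [] []]|[_ [] []]]].
apply/hasPn => u; rewrite mem_cat => /orP[] hu; apply/negP => /VV_typesP[k _ uE];
  move: hu; rewrite uE.
  by move=> /VS_typesP[k' _ [[h]|[_ [h]]]]; lia.
by move=> /SS_typesP[k' _ [[rh _ [_ []]]|[_ [] []]|[_ [] []]]].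
Qed.

End Types.

(** * The position of the centre *)

Section Signs.
Context {R : realType} {m : nat} (hm : (3 <= m)%N) (P : regular_polygon R m).
Implicit Types (i j k l : int) (e f : bool) (s t : R).

(** The sine of the central angle 2 pi k / m of k sides. *)
Definition central_sin k : R := sin_frac (m := m) (2 * k).

Lemma central_sin_gt0 k : 0 < k -> 2 * k < m%:Z -> 0 < central_sin k.
Proof. by move=> k0 km; apply: sin_frac_gt0 => //; lia. Qed.

Lemma central_sin_ge0 k : 0 <= k -> 2 * k <= m%:Z -> 0 <= central_sin k.
Proof. by move=> k0 km; apply: sin_frac_ge0 => //; lia. Qed.

Lemma orient_vtx_center i j :
  orient (vtx P i) (vtx P j) (center P) = radius P ^+ 2 * central_sin (j - i).
Proof.
rewrite /central_sin /sin_frac.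
have -> : pi / m%:R * (2 * (j - i))%:~R = angle P i - angle P j.
  by rewrite /angle intrM intrB; ring.
by rewrite sinB !vtxE /orient /=; ring.
Qed.

Lemma orient_side_point_center i e s j f t (s' := if e then s else 0)
    (t' := if f then t else 0) :
  orient (side_point P i e s) (side_point P j f t) (center P) = radius P ^+ 2 *
    ((1 - s') * ((1 - t') * central_sin (j - i) + t' * central_sin (j - i + 1))
     + s' * ((1 - t') * central_sin (j - i - 1) + t' * central_sin (j - i))).
Proof.
have bE k g u : side_point P k g u = (1 - (if g then u else 0)) *: vtx P k
    + (if g then u else 0) *: vtx P (k + 1).
  by rewrite /side_point; case: g; rewrite // subr0 scale0r addr0 scale1r.
rewrite !bE -/s' -/t'.
transitivity ((1 - s') * ((1 - t') * orient (vtx P i) (vtx P j) (center P)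
     + t' * orient (vtx P i) (vtx P (j + 1)) (center P))
   + s' * ((1 - t') * orient (vtx P (i + 1)) (vtx P j) (center P)
     + t' * orient (vtx P (i + 1)) (vtx P (j + 1)) (center P))).
  by rewrite /orient /= /GRing.scale /=; ring.
rewrite !orient_vtx_center.
have -> : j + 1 - i = j - i + 1 by ring.
have -> : j - (i + 1) = j - i - 1 by ring.
have -> : j + 1 - (i + 1) = j - i by ring.
ring.
Qed.

Lemma sgz_orient_center i e s j f t (s' := if e then s else 0)
    (t' := if f then t else 0) :
  sgz (orient (side_point P i e s) (side_point P j f t) (center P)) =
  sgz ((1 - s') * ((1 - t') * central_sin (j - i) + t' * central_sin (j - i + 1))
     + s' * ((1 - t') * central_sin (j - i - 1) + t' * central_sin (j - i))).
Proof.
rewrite orient_side_point_center sgzM gtr0_sgz ?mul1r // exprn_gt0 //.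
exact: radius_gt0.
Qed.

Lemma sin_frac_addm l : sin_frac (R := R) (m := m) (m%:Z + l) = - sin_frac (R := R) (m := m) l.
Proof. by rewrite -[l]opprK sin_frac_compl // sin_fracN !opprK. Qed.

Lemma central_sin_odd k : 2 * k = m%:Z - 1 ->
  0 < central_sin k /\ central_sin (k + 1) = - central_sin k.
Proof.
move=> km; rewrite /central_sin mulrDr mulr1 km.
have -> : m%:Z - 1 + 2 = m%:Z + 1 by lia.
rewrite (sin_frac_addm 1) sin_frac_compl //; split=> //.
by apply: sin_frac_gt0 => //; lia.
Qed.

Lemma central_sin_even k : 2 * k = m%:Z ->
  [/\ central_sin k = 0, 0 < central_sin (k - 1) & central_sin (k + 1) = - central_sin (k - 1)].
Proof.
have e1 : 2 * (k - 1) = 2 * k - 2 by ring.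
have e2 : 2 * (k + 1) = 2 * k + 2 by ring.
move=> km; rewrite /central_sin e1 e2 km (sin_frac_addm 2) sin_frac_compl //; split=> //.
  by rewrite -[m%:Z]addr0 sin_frac_addm sin_frac0 oppr0.
by apply: sin_frac_gt0 => //; lia.
Qed.

Lemma bilinear_gt0 (s t a b d : R) : 0 < s < 1 -> 0 < t < 1 -> 0 < a -> 0 <= b -> 0 <= d ->
  0 < (1 - s) * ((1 - t) * a + t * b) + s * ((1 - t) * d + t * a).
Proof.
move=> /andP[s0 s1] /andP[t0 t1] a0 b0 d0.
have s1' : 0 < 1 - s by lra.
have t1' : 0 < 1 - t by lra.
have h1 : 0 <= (1 - s) * (t * b) by rewrite !mulr_ge0 // ltW.
have h2 : 0 <= s * ((1 - t) * d) by rewrite !mulr_ge0 // ltW.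
have h3 : 0 < (1 - s) * ((1 - t) * a) by rewrite !mulr_gt0.
have h4 : 0 < s * (t * a) by rewrite !mulr_gt0.
rewrite !mulrDr; lra.
Qed.

(** The situation for d = m - 1, where the arc between the far ends of the two
sides exceeds half a turn and contributes the negative coefficient - a. *)
Lemma bilinear_odd_gt0 (s t a d : R) : 0 < s < 1 -> 0 < t < 1 -> 0 < a -> 0 <= d ->
  0 < 1 - s - 2 * t + 3 * s * t ->
  0 < (1 - s) * ((1 - t) * a + t * - a) + s * ((1 - t) * d + t * a).
Proof.
move=> /andP[s0 s1] /andP[t0 t1] a0 d0 h.
have h2 : 0 <= s * ((1 - t) * d) by rewrite !mulr_ge0 //; lra.
have -> : (1 - s) * ((1 - t) * a + t * - a) + s * ((1 - t) * d + t * a)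
  = a * (1 - s - 2 * t + 3 * s * t) + s * ((1 - t) * d) by ring.
by apply: ltr_wpDr => //; rewrite mulr_gt0.
Qed.

Lemma odd_factor_gt0 (s t : R) : 0 < t -> s < 1 -> t <= s -> 0 < 1 - s - 2 * t + 3 * s * t.
Proof.
move=> t0 s1 ts; have [h|h] := lerP t (1 / 2).
  have : 0 <= (1 - s) * (1 - 2 * t) by rewrite mulr_ge0; lra.
  have : 0 < s * t by rewrite mulr_gt0 //; lra.
  lra.
have : 0 <= (s - t) * (3 * t - 1) by rewrite mulr_ge0; lra.
have : 0 <= (t - 1 / 2) ^+ 2 by exact: sqr_ge0.
rewrite expr2; lra.
Qed.

Lemma sgz_cases (x : R) : [\/ sgz x = 1, sgz x = 0 | sgz x = -1].
Proof.
have [h|h|->] := ltgtP x 0.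
- by constructor 3; rewrite ltr0_sgz.
- by constructor 1; rewrite gtr0_sgz.
- by constructor 2; rewrite sgz0.
Qed.

Lemma sgz_mem (x : R) : sgz x \in [:: (-1)%Z; 0%Z; 1%Z].
Proof. by have [] := sgz_cases x => ->. Qed.

(** The coefficients sin (2 pi n / m) of the determinant are nonnegative as long as
the arcs between the ends of the two cells are at most half a turn. The cases
d = m - 1 and d = m remain, in which one or two of them change sign or
vanish. *)
Lemma type_feasible i e s j f t :
  0 < s < 1 -> 0 < t < 1 -> separated m i e j f ->
  normal m (type_at P i e s j f t) ->
  type_at P i e s j f t \in (if e && f then SS_types m else VV_types m ++ VS_types m).
Proof.
move=> s01 t01; rewrite /type_at sgz_orient_center /separated /cell.
have [[s0 s1] [t0 t1]] := (andP s01, andP t01).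
have dE : 2 * j + f%:Z - (2 * i + e%:Z) = 2 * (j - i) + f%:Z - e%:Z by ring.
rewrite dE; set n := j - i.
case: e f dE => -[] /= dE sep nor.
- have dn : 2 * n + 1 - 1 = 2 * n by ring.
  rewrite dn in sep nor *; apply/(SS_typesP hm); exists n; first by lia.
  have [h1|h1] := boolP (2 * n + 2 <= m%:Z).
    rewrite gtr0_sgz.
      by constructor 1; exists (sgz (t - s)); [exact: sgz_mem|split=> //; lia].
    apply: bilinear_gt0 => //;
      [apply: central_sin_gt0|apply: central_sin_ge0|apply: central_sin_ge0] => //; lia.
  have [h2|h2] := eqVneq (2 * n) (m%:Z - 1).
    have [a0 bE] := central_sin_odd h2; rewrite bE.
    have d0 : 0 <= central_sin (n - 1) by apply: central_sin_ge0 => //; lia.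
    have [st|ts] := ltrP s t.
      rewrite [sgz (t - s)]gtr0_sgz ?subr_gt0 //.
      have [] := sgz_cases ((1 - s) * ((1 - t) * central_sin n + t * - central_sin n) +
         s * ((1 - t) * central_sin (n - 1) + t * central_sin n)) => ->.
      + by constructor 1; exists 1 => //; split=> //; lia.
      + by constructor 2; split=> //; left.
      + by constructor 2; split=> //; right.
    rewrite gtr0_sgz.
      by constructor 1; exists (sgz (t - s)); [exact: sgz_mem|split=> //; lia].
    by apply: bilinear_odd_gt0 => //; exact: odd_factor_gt0.
  have h3 : 2 * n = m%:Z by lia.
  have [aE d0 bE] := central_sin_even h3.
  have sE : sgz ((1 - s) * ((1 - t) * central_sin n + t * central_sin (n + 1)) +
         s * ((1 - t) * central_sin (n - 1) + t * central_sin n)) = - sgz (t - s).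
    rewrite -sgzN opprB aE bE.
    transitivity (sgz ((s - t) * central_sin (n - 1))); first by congr sgz; ring.
    by rewrite sgzM (gtr0_sgz d0) mulr1.
  rewrite sE in nor *; constructor 3; split=> //.
  move: nor; have [] := sgz_cases (t - s) => ->; first by lia.
    by left.
  by right.
- rewrite mem_cat; apply/orP; right; apply/(VS_typesP hm); exists (n - 1); first by lia.
  have dn : 2 * n + 0 - 1 = 2 * (n - 1) + 1 by ring.
  rewrite dn in sep nor *; rewrite !(mul0r, subr0, addr0, mul1r) in nor *.
  have [h|h] := boolP (2 * (n - 1) + 1 == m%:Z); last first.
    left; rewrite gtr0_sgz //.
    have : 0 < s * central_sin (n - 1) by rewrite mulr_gt0 // central_sin_gt0 //; lia.
    have : 0 <= (1 - s) * central_sin n by rewrite mulr_ge0 ?central_sin_ge0 //; [lra|lia|lia].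
    lra.
  move: nor; have [] := sgz_cases ((1 - s) * central_sin n + s * central_sin (n - 1)) => ->.
  + by left.
  + by right; split=> //; lia.
  + lia.
- rewrite mem_cat; apply/orP; right; apply/(VS_typesP hm); exists n; first by lia.
  have dn : 2 * n + 1 - 0 = 2 * n + 1 by ring.
  rewrite dn in sep nor *; rewrite !(mul0r, subr0, addr0, mul1r) in nor *.
  have [h|h] := boolP (2 * n + 1 == m%:Z); last first.
    left; rewrite gtr0_sgz //.
    have : 0 < (1 - t) * central_sin n by rewrite mulr_gt0 ?central_sin_gt0 //; [lra|lia|lia].
    have : 0 <= t * central_sin (n + 1) by rewrite mulr_ge0 ?central_sin_ge0 //; [lra|lia|lia].
    lra.
  move: nor; have [] := sgz_cases ((1 - t) * central_sin n + t * central_sin (n + 1)) => ->.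
  + by left.
  + by right; split=> //; lia.
  + lia.
- rewrite mem_cat; apply/orP; left; apply/(VV_typesP hm); exists n; first by lia.
  have dn : 2 * n + 0 - 0 = 2 * n by ring.
  rewrite dn in sep nor *; rewrite !(mul0r, subr0, addr0, mul1r).
  congr (_, _, _, _); case: ltP => h.
    by rewrite gtr0_sgz // central_sin_gt0 //; lia.
  have h3 : 2 * n = m%:Z by lia.
  by have [-> _ _] := central_sin_even h3; rewrite sgz0.
Qed.

End Signs.

(** * Every listed type occurs *)

Section Realization.
Context {R : realType} {m : nat} (hm : (3 <= m)%N) (P : regular_polygon R m).
Implicit Types (i j k l : int) (e f : bool) (s t : R).
Implicit Types (c : chord R) (u : cut_type).

Local Notation central_sin := (@central_sin R m).

Lemma has_type_at e s k f t : 0 < s < 1 -> 0 < t < 1 -> separated m 0 e k f ->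
  has_type P (chord_at P 0 e s k f t) (type_at P 0 e s k f t).
Proof. by move=> s01 t01 sep; exists 0, e, s, k, f, t; split=> //; left. Qed.

(** The quantity whose sign places the centre, for two sides k apart. *)
Definition center_form s t k := (1 - s) * ((1 - t) * central_sin k + t * central_sin (k + 1))
  + s * ((1 - t) * central_sin (k - 1) + t * central_sin k).

Lemma SS_type_at s t k : type_at P 0 true s k true t =
  (2 * k, true, sgz (center_form s t k), sgz (t - s)).
Proof.
rewrite /type_at sgz_orient_center /cell /= subr0; congr (_, _, _, _); lia.
Qed.

Lemma VS_type_at s t k : type_at P 0 false s k true t =
  (2 * k + 1, false, sgz ((1 - t) * central_sin k + t * central_sin (k + 1)), 0).
Proof.
rewrite /type_at sgz_orient_center /cell /= subr0.
by rewrite !(subr0, mul1r, mul0r, addr0).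
Qed.

Lemma VV_type_at s t k : type_at P 0 false s k false t = (2 * k, false, sgz (central_sin k), 0).
Proof.
rewrite /type_at sgz_orient_center /cell /= subr0.
by rewrite !(subr0, mul1r, mul0r, addr0).
Qed.

Lemma center_form_gt0 s t k : 0 < s < 1 -> 0 < t < 1 -> 2 <= 2 * k ->
  2 * k < m%:Z -> 0 < 1 - s - 2 * t + 3 * s * t -> 0 < center_form s t k.
Proof.
move=> s01 t01 k1 km h; rewrite /center_form.
have [h1|h1] := boolP (2 * k + 2 <= m%:Z).
  by apply: bilinear_gt0 => //;
      [apply: central_sin_gt0|apply: central_sin_ge0|apply: central_sin_ge0] => //; lia.
have [a0 ->] : 0 < central_sin k /\ central_sin (k + 1) = - central_sin k
      by apply: central_sin_odd => //; lia.
by apply: bilinear_odd_gt0 => //; apply: central_sin_ge0 => //; lia.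
Qed.

(** For d < m, ratios with the wanted order that make the factor of
[bilinear_odd_gt0] positive serve for every d. The two types special to odd m
come from solving for t with s = 1 / 4. *)
Lemma SS_realized u : u \in SS_types m -> exists c, has_type P c u.
Proof.
have half01 : 0 < (1 / 2 : R) < 1 by lra.
have real s t k : 0 < s < 1 -> 0 < t < 1 -> 2 <= 2 * k <= m%:Z ->
    exists c, has_type P c (2 * k, true, sgz (center_form s t k), sgz (t - s)).
  move=> s01 t01 hk; rewrite -SS_type_at.
  exists (chord_at P 0 true s k true t); apply: has_type_at => //.
  by clear -hk hm; rewrite /separated /cell; lia.
move=> /(SS_typesP hm)[k hk [[rh rhE [km ->]]|[km h]|[km h]]].
- have pos s t : 0 < s < 1 -> 0 < t < 1 -> 0 < 1 - s - 2 * t + 3 * s * t ->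
      exists c, has_type P c (2 * k, true, 1, sgz (t - s)).
    move=> s01 t01 h; have k2 : 2 <= 2 * k by lia.
    by have := real s t k s01 t01 hk; rewrite (gtr0_sgz (center_form_gt0 s01 t01 k2 km h)).
  move: rhE; rewrite !inE => /or3P[] /eqP ->.
  + have E : sgz (1 / 3 - 2 / 3 : R) = (-1)%Z by rewrite ltr0_sgz //; lra.
    by have := pos (2 / 3) (1 / 3); rewrite E; apply; lra.
  + have E : sgz (1 / 2 - 1 / 2 : R) = 0%Z by rewrite subrr sgz0.
    by have := pos (1 / 2) (1 / 2); rewrite E; apply; lra.
  + have E : sgz (1 / 4 - 1 / 8 : R) = 1%Z by rewrite gtr0_sgz //; lra.
    by have := pos (1 / 8) (1 / 4); rewrite E; apply; lra.
- have [a0 bE] := central_sin_odd (R := R) hm km.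
  have d0 : 0 <= central_sin (k - 1) by apply: central_sin_ge0 => //; lia.
  set a := central_sin k in a0 bE; set d := central_sin (k - 1) in d0.
  have D0 : 0 < 5 * a + d by lra.
  have val t : center_form (1 / 4) t k = ((3 * a + d) - t * (5 * a + d)) / 4.
    by rewrite /center_form bE -/a -/d; field.
  (* The centre lies on the chord for w = 3 a + d, beyond it for larger w. *)
  have tval w : 3 * a + d <= w -> w < 5 * a + d ->
      0 < w / (5 * a + d) < 1 /\ sgz (w / (5 * a + d) - 1 / 4) = 1.
    move=> w1 w2; split.
      by rewrite divr_gt0 //= ?ltr_pdivrMr //; lra.
    by rewrite gtr0_sgz // subr_gt0 ltr_pdivlMr //; lra.
  have q01 : 0 < (1 / 4 : R) < 1 by lra.
  case: h => ->.
    have [||t01 tE] := tval (3 * a + d); [lra|lra|].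
    have := real (1 / 4) ((3 * a + d) / (5 * a + d)) k q01 t01 hk.
    by rewrite tE val divfK ?lt0r_neq0 // subrr mul0r sgz0.
  have [||t01 tE] := tval (4 * a + d); [lra|lra|].
  have := real (1 / 4) ((4 * a + d) / (5 * a + d)) k q01 t01 hk.
  by rewrite tE val divfK ?lt0r_neq0 // ltr0_sgz //; lra.
- have [aE d0 bE] := central_sin_even (R := R) hm km.
  have val s t : sgz (center_form s t k) = - sgz (t - s).
    rewrite -sgzN opprB /center_form aE bE.
    transitivity (sgz ((s - t) * central_sin (k - 1))); first by congr sgz; ring.
    by rewrite sgzM (gtr0_sgz d0) mulr1.
  case: h => ->.
    by have := real (1 / 2) (1 / 2) k half01 half01 hk; rewrite val subrr sgz0 oppr0.
  have a01 : 0 < (2 / 3 : R) < 1 by lra.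
  have b01 : 0 < (1 / 3 : R) < 1 by lra.
  have := real (2 / 3) (1 / 3) k a01 b01 hk; rewrite val.
  by rewrite ltr0_sgz ?opprK //; lra.
Qed.

Lemma VV_realized u : u \in VV_types m -> exists c, has_type P c u.
Proof.
have half01 : 0 < (1 / 2 : R) < 1 by lra.
move=> /(VV_typesP hm)[k hk ->]; exists (chord_at P 0 false (1 / 2) k false (1 / 2)).
have <- : type_at P 0 false (1 / 2) k false (1 / 2)
    = (2 * k, false, if 2 * k < m%:Z then 1%Z else 0%Z, 0%Z).
  rewrite VV_type_at; congr (_, _, _, _); case: ltP => h.
    by rewrite gtr0_sgz // central_sin_gt0 //; lia.
  have h3 : 2 * k = m%:Z by lia.
  by have [-> _ _] := central_sin_even (R := R) hm h3; rewrite sgz0.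
apply: has_type_at => //.
by clear -hk hm; rewrite /separated /cell; lia.
Qed.

Lemma VS_realized u : u \in VS_types m -> exists c, has_type P c u.
Proof.
have half01 : 0 < (1 / 2 : R) < 1 by lra.
have quarter01 : 0 < (1 / 4 : R) < 1 by lra.
move=> /(VS_typesP hm)[k hk [->|[km ->]]].
  exists (chord_at P 0 false (1 / 2) k true (1 / 4)).
  have <- : type_at P 0 false (1 / 2) k true (1 / 4) = (2 * k + 1, false, 1%Z, 0%Z).
    rewrite VS_type_at gtr0_sgz //.
    have a0 : 0 < central_sin k by apply: central_sin_gt0 => //; lia.
    have [h|h] := boolP (2 * k + 2 <= m%:Z).
      have : 0 <= central_sin (k + 1) by apply: central_sin_ge0 => //; lia.
      lra.
    have [_ ->] : 0 < central_sin k /\ central_sin (k + 1) = - central_sin k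
      by apply: central_sin_odd => //; lia.
    lra.
  by apply: has_type_at => //; clear -hk hm; rewrite /separated /cell; lia.
exists (chord_at P 0 false (1 / 2) k true (1 / 2)).
have <- : type_at P 0 false (1 / 2) k true (1 / 2) = (2 * k + 1, false, 0%Z, 0%Z).
  rewrite VS_type_at; have [_ ->] : 0 < central_sin k /\ central_sin (k + 1) = - central_sin k
      by apply: central_sin_odd => //; lia.
  by congr (_, _, _, _); rewrite (_ : _ + _ = 0) ?sgz0 //; lra.
by apply: has_type_at => //; clear -hk hm; rewrite /separated /cell; lia.
Qed.

Lemma all_types_realized u : u \in all_types m -> exists c, has_type P c u.
Proof.
rewrite mem_all_types => /or3P[]; [exact: VV_realized|exact: VS_realized|exact: SS_realized].
Qed.

Lemma has_type_listed c u : has_type P c u -> normal m u -> u \in all_types m.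
Proof.
move=> [i [e [s [j [f [t [[s01 t01] sep _ <-]]]]]]] /(type_feasible hm s01 t01 sep).
by rewrite mem_all_types; case: ifP => _ => [|/[1!mem_cat]/orP[]] ->; rewrite ?orbT.
Qed.

Lemma normal_type c : is_cut P c -> exists u, has_type P c u /\ normal m u.
Proof.
move=> /(is_cut_has_type hm)[u uc].
have [nu|nu] := boolP (normal m u); first by exists u.
exists (swap_type m u); split; first exact: has_type_swap.
by move: nu; clear; case: u => [[[d b] sg] rh] /=; lia.
Qed.

Lemma geotypeE c u : has_type P c u -> geotype P c = [set c' | has_type P c' u].
Proof.
move=> uc; apply/seteqP; split=> c' /=.
  move=> [/(is_cut_has_type hm)[u' uc'] /(same_geotypeP hm uc uc')[<- //|uE]].
  by rewrite -(swap_typeK m u) -uE; exact: has_type_swap.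
by move=> uc'; split; [exact: has_type_is_cut uc'|apply/(same_geotypeP hm uc uc'); left].
Qed.

(** If both readings are normal, then d = m and the centre lies on the chord; the
lists show that the two endpoints are then compared equal, so the readings have
the same data. *)
Lemma normal_unique c u u' : has_type P c u -> has_type P c u' -> normal m u ->
  normal m u' -> u = u'.
Proof.
move=> uc uc' nu nu'.
have cc : same_geotype P c c by apply/(same_geotypeP hm uc uc); left.
have [->//|uE] := (same_geotypeP hm uc uc').1 cc.
have := has_type_listed uc nu; move: nu nu'; rewrite uE.
rewrite mem_all_types => nu nu' /or3P[/(VV_typesP hm)|/(VS_typesP hm)|/(SS_typesP hm)].
- move=> [k _ uE']; move: nu nu'; rewrite uE' /= => nu nu'.
  by congr (_, _, _, _); lia.
- by move=> [k _ [uE'|[_ uE']]]; move: nu nu'; rewrite uE' /= => nu nu';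
    congr (_, _, _, _); lia.
- move=> [k _ [[rh _ [km uE']]|[km [] uE']|[km [] uE']]]; move: nu nu'; rewrite uE' /= => nu nu';
    by [congr (_, _, _, _); lia|exfalso; lia].
Qed.

Lemma all_types_normal u : u \in all_types m -> normal m u.
Proof.
rewrite mem_all_types => /or3P[/(VV_typesP hm)|/(VS_typesP hm)|/(SS_typesP hm)].
- by move=> [k hk ->] /=; case: ltP; lia.
- by move=> [k hk [->|[km ->]]] /=; lia.
- by move=> [k hk [[rh _ [km ->]]|[km [] ->]|[km [] ->]]] /=; lia.
Qed.

(** By [geotypeE], these are the geometrical types. *)
Definition type_class u : set (chord R) := [set c | has_type P c u].

Lemma type_class_inj : {in all_types m &, injective type_class}.
Proof.
move=> u u' uL uL' uE; have [c uc] := all_types_realized uL.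
have uc' : has_type P c u' by move: (uc); rewrite -[has_type P c u]/(type_class u c) uE.
by apply: (normal_unique uc uc'); exact: all_types_normal.
Qed.

Lemma geotypes_cut : geotype P @` is_cut P = type_class @` [set` all_types m].
Proof.
apply/seteqP; split=> X.
  move=> [c cP <-]; have [u [uc nu]] := normal_type cP; exists u; first exact: has_type_listed uc nu.
  by rewrite (geotypeE uc).
move=> [u uL <-]; have [c uc] := all_types_realized uL; exists c; first exact: has_type_is_cut uc.
by rewrite (geotypeE uc).
Qed.

Lemma SS_cut_type c u : is_SS_cut P c -> has_type P c u -> normal m u -> u \in SS_types m.
Proof.
move=> [_ [a [b [_ ca cb]]]] [i [e [s [j [f [t [[s01 t01] sep cE <-]]]]]]].
move=> /(type_feasible hm s01 t01 sep).
have -> // : e && f.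
case: cE ca cb => -> /=.
  by move=> /(open_side_point hm _ _ _ _ s01)[eT _] /(open_side_point hm _ _ _ _ t01)[fT _];
    rewrite eT fT.
by move=> /(open_side_point hm _ _ _ _ t01)[fT _] /(open_side_point hm _ _ _ _ s01)[eT _];
  rewrite eT fT.
Qed.

Lemma type_SS_cut c u : has_type P c u -> u \in SS_types m -> is_SS_cut P c.
Proof.
move=> uc uL; split; first exact: has_type_is_cut uc.
have ub : u.1.1.2 = true.
  by move: uL => /(SS_typesP hm)[k _ [[rh _ [_ ->]]|[_ [] ->]|[_ [] ->]]].
move: uc => [i [e [s [j [f [t [[s01 t01] sep cE uE]]]]]]].
move: ub; rewrite -uE /= => /andP[eE fE]; rewrite eE fE in sep cE.
have [a [k ak]] := int_ord i hm; have [b [k' bk]] := int_ord j hm.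
have ia : same_cell m i true (a : nat)%:Z true.
  by split=> //; exists (- k); rewrite ak mulNr addrK.
have jb : same_cell m j true (b : nat)%:Z true.
  by split=> //; exists (- k'); rewrite bk mulNr addrK.
have ab : a != b.
  by apply/eqP => abE; apply: (separated_not_both sep ia); rewrite abE.
have oa : open_side P a (side_point P i true s) by apply/(open_side_point hm).
have ob : open_side P b (side_point P j true t) by apply/(open_side_point hm).
by case: cE => ->; [exists a, b|exists b, a; rewrite eq_sym].
Qed.

Lemma geotypes_SS_cut : geotype P @` is_SS_cut P = type_class @` [set` SS_types m].
Proof.
apply/seteqP; split=> X.
  move=> [c cSS <-]; have [u [uc nu]] := normal_type cSS.1.
  by exists u; [exact: SS_cut_type uc nu|rewrite (geotypeE uc)].
move=> [u uL <-]; have [c uc] := SS_realized uL.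
by exists c; [exact: type_SS_cut uc uL|rewrite (geotypeE uc)].
Qed.

End Realization.

(** * Counting *)

Lemma card_fset_set_image (T : eqType) (U : choiceType) (F : T -> U) (L : seq T) :
  uniq L -> {in L &, injective F} ->
  #|` fset_set (F @` [set` L])| = size L.
Proof.
move=> uL injF.
have -> : F @` [set` L] = [set` seq_fset tt (map F L)].
  apply/seteqP; split=> y /=.
    by move=> [x xL <-]; have := seq_fsetE tt (map F L) (F x); rewrite map_f.
  by move: (seq_fsetE tt (map F L) y) => -> /mapP[x xL ->]; exists x.
by rewrite set_fsetK size_seq_fset undup_id ?map_inj_in_uniq // size_map.
Qed.

Section CountWays.
Context {R : realType} {m : nat} (hm : (3 <= m)%N) (P : regular_polygon R m).

Lemma N_SS_polygon : N_SS P = (3 * (m.-1)./2 + 2)%N.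
Proof.
rewrite /N_SS leqNgt hm /= geotypes_SS_cut //.
have inj : {in SS_types m &, injective (type_class P)}.
  move=> u u' uL uL'; apply: type_class_inj => //; rewrite mem_all_types;
  by rewrite ?uL ?uL' !orbT.
by rewrite (card_fset_set_image (uniq_SS hm) inj) size_SS_types.
Qed.

Lemma Xi_geo_polygon : Xi_geo P = (N_div m * size (all_types m))%N.
Proof.
pose L := [seq (d, u) | d <- divisors m, u <- all_types m].
pose F (x : nat * cut_type) := (x.1, type_class P x.2).
have uL : uniq L.
  by apply: allpairs_uniq; [exact: divisors_uniq|exact: uniq_all_types|move=> [? ?] [? ?]].
have injF : {in L &, injective F}.
  move=> [d u] [d' u'] /allpairsP[[a b] [_ /= uA [_ ->]]] /allpairsP[[a' b'] [_ /= uA' [_ ->]]].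
  by move=> [-> /(type_class_inj hm uA uA') ->].
rewrite /Xi_geo (_ : ways_of_cutting P = F @` [set` L]).
  by rewrite card_fset_set_image // size_allpairs.
apply/seteqP; split=> -[d v] /=.
  move=> [d0 [dm cv]]; rewrite /= in d0 dm cv.
  have : (geotype P @` is_cut P) v by case: cv => c cP ->; exists c.
  rewrite geotypes_cut // => -[u uA <-]; exists (d, u) => //.
  by apply/allpairsP; exists (d, u); split=> //=; rewrite -dvdn_divisors //; lia.
move=> [[a u] /allpairsP[[a' u'] [/= aD uA [-> ->]]] [<- <-]].
have dm : (a' %| m)%N by rewrite dvdn_divisors //; lia.
have : (geotype P @` is_cut P) (type_class P u') by rewrite geotypes_cut //; exists u'.
move=> [c cP <-]; split; first by apply: dvdn_gt0 dm; lia.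
by split=> //; exists c.
Qed.

End CountWays.

Local Close Scope ring_scope.
Local Close Scope classical_set_scope.

Theorem theorem1 (R : realType) (m : nat) (hm : 3 <= m)
    (P : regular_polygon R m) (Q : regular_polygon R (m - 2)) :
  (~~ odd m -> Xi_geo P = N_div m * (m + 1 + N_SS Q)) /\
  (odd m -> Xi_geo P = N_div m * (m + 2 + N_SS Q)).
Proof.
(* For m - 2 <= 2 the right-hand side is the conventional value 2. *)
have NQ : N_SS Q = 3 * ((m - 2).-1)./2 + 2.
  have [m4|m5] := leqP (m - 2) 2; last exact: N_SS_polygon.
  rewrite /N_SS m4.
  by have -> : ((m - 2).-1)./2 = 0 by lia.
rewrite Xi_geo_polygon // NQ size_all_types //.
by split=> mo; congr (_ * _); lia.
Qed.
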